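(* For every $n\ge 2$, the gap process $\mathbf{Y}=(Y_1,\dots,Y_{n-1})$ (the Markov process on $\mathbb{R}_+^{n-1}$ with generator $\mathcal{L}_n$ described in the context) has a unique stationary distribution $\pi_n$.
   Context: Fix $n\ge 2$ and a probability law $\theta$ on $(0,\infty)$ with $\int z\,\theta(dz)=1$. The $n$-particle Stochastic Follow-the-Leader system $\mathbf{X}=(X_1,\dots,X_n)$ on $\mathbb{R}$, with $X_n(t)<\dots<X_1(t)$, evolves as a pure jump Markov process: the leader $X_1$ jumps forward at rate $1$ with i.i.d. jump sizes of law $\theta$; for $i\ge 2$, particle $X_i$ jumps at rate $X_{i-1}-X_i$ to a location chosen uniformly in $(X_i,X_{i-1})$. The gap process is $Y_i(t)=X_i(t)-X_{i+1}(t)$, $i=1,\dots,n-1$; it is a Markov process on $\mathbb{R}_+^{n-1}$ whose generator acts on bounded measurable $f$ by $$\mathcal{L}_nf(\mathbf{y})=y_{n-1}\mathbb{E}_U[f(\mathbf{y}-y_{n-1}Ue_{n-1})-f(\mathbf{y})]+\sum_{i=1}^{n-2}y_i\mathbb{E}_U[f(\mathbf{y}+y_iU(e_{i+1}-e_i))-f(\mathbf{y})]+\mathbb{E}_\theta[f(\mathbf{y}+Ze_1)-f(\mathbf{y})],$$ where $U\sim\mathrm{U}(0,1)$, $Z\sim\theta$, and $e_i$ are the standard basis vectors. $\mathbb{P}_{\mathbf{y}}$ denotes the law of $\mathbf{Y}$ started at $\mathbf{y}$. *)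

(* Defs.v *)
From HB Require Import structures.
From mathcomp Require Import all_boot all_order all_algebra.
From mathcomp Require Import all_classical all_reals all_analysis.
Set Implicit Arguments. Unset Strict Implicit. Unset Printing Implicit Defensive.
Import Order.TTheory GRing.Theory Num.Theory.
Local Open Scope classical_set_scope.
Local Open Scope ring_scope.

Section SFTL.
Variable R : realType.
Variable m : nat.  (* m = n - 1 = number of gaps *)

Definition state := m.-tuple R.

Definition orthant : set state := [set y | forall j : 'I_m, 0 <= tnth y j].

(* y + c e_i  (0-based index i; no-op if i >= m) *)
Definition addat (y : state) (i : nat) (c : R) : state :=
  [tuple nth (0:R) y j + (if val j == i then c else 0) | j < m].

(* total jump rate: y_{n-1} + sum_{i<=n-2} y_i + 1 *)
Definition rate (y : state) : R := 1 + \sum_(j < m) tnth y j.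

(* the three kinds of jumps of the gap process (0-based indices):
   last gap shrinks: y - y_{n-1} u e_{n-1};
   gap i passes mass to gap i+1: y + y_i u (e_{i+1} - e_i);
   leader jump: y + z e_1 *)
Definition jump_last (y : state) (u : R) : state :=
  addat y m.-1 (- (nth 0 y m.-1 * u)).
Definition jump_mid (y : state) (i : nat) (u : R) : state :=
  addat (addat y i (- (nth 0 y i * u))) i.+1 (nth 0 y i * u).
Definition jump_lead (y : state) (z : R) : state := addat y 0 z.

Definition ycoord (y : state) (i : nat) : R := nth 0 y i.

Definition decay (y : state) (s : R) : R := expR (- (rate y * s)).

Local Open Scope ereal_scope.

(* integral of g against the (unnormalised) jump-rate measure Q(y, dz) of L_n:
   Q(y,.)g = y_{n-1} E_U[g(y - y_{n-1} U e_{n-1})]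
           + sum_{i=1}^{n-2} y_i E_U[g(y + y_i U (e_{i+1} - e_i))]
           + E_theta[g(y + Z e_1)]      (0-based indices below) *)
Definition jumpint (theta : probability R R) (g : state -> \bar R) (y : state)
  : \bar R :=
  (ycoord y m.-1)%:E *
     \int[@lebesgue_measure R]_(u in `[0%R, 1%R] : set R) g (jump_last y u)
  + \sum_(i < m.-1)
       ((ycoord y i)%:E *
         \int[@lebesgue_measure R]_(u in `[0%R, 1%R] : set R) g (jump_mid y i u))
  + \int[theta]_z g (jump_lead y z).

(* Picard iterates of the backward Kolmogorov integral equation
   P_t(y,A) = e^{-rate y t} 1_A(y)
            + int_0^t e^{-rate y s} Q(y,dz) P_{t-s}(z,A) ds *)
Fixpoint Piter (theta : probability R R) (k : nat) (t : R) (y : state)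
  (A : set state) : \bar R :=
  match k with
  | 0 => (decay y t)%:E * (\1_A y)%:E
  | k'.+1 => (decay y t)%:E * (\1_A y)%:E
      + \int[@lebesgue_measure R]_(s in `[0%R, t] : set R)
          ((decay y s)%:E *
             jumpint theta (fun z => Piter theta k' (t - s)%R z A) y)
  end.

(* transition function of the (minimal) pure-jump process with generator L_n:
   P_t(y, A) = P_y(Y(t) \in A) *)
Definition Ptrans (theta : probability R R) (t : R) (y : state) (A : set state)
  : \bar R := ereal_sup (range (fun k => Piter theta k t y A)).

Definition stationary (theta : probability R R) (pi : probability state R) : Prop :=
  pi orthant = 1 /\
  forall t : R, (0 <= t)%R -> forall A : set state, measurable A ->
    \int[pi]_(y in orthant) Ptrans theta t y A = pi A.

End SFTL.

(* Main.v *)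
(* The gap process satisfies a Doeblin condition uniformly over the whole
   orthant, and this yields existence and uniqueness at once.
   The transition function is the supremum of the Picard iterates of the backward
   equation; it is dominated by any supersolution of that equation. For the
   Lyapunov function V(y) = sum_i (n - i) y_i one has L V = (n - 1) - |y|^2 / 2.
   The supersolution V + C t bounds the expected number of jumps, so there is no
   explosion; the supersolution V / (1 + c t V) + (n - 1) t is bounded at any
   fixed t > 0, so the process comes down from infinity in bounded time. From a
   bounded set, a jump of the leader followed by one jump of each of the other
   particles, in order, dominates a multiple of Lebesgue measure on a small cube.
   Hence the oscillation of P_{kT} 1_A decays geometrically in k, uniformly in A;
   its limit is the stationary law. *)
Require Import Defs.
From HB Require Import structures.
From mathcomp Require Import all_boot all_order all_algebra.
From mathcomp Require Import all_classical all_reals all_analysis.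
From mathcomp Require Import measurable_realfun ring lra.
Import Order.TTheory GRing.Theory Num.Theory.
Import numFieldNormedType.Exports.
Local Open Scope classical_set_scope.
Local Open Scope ring_scope.

Set Implicit Arguments. Unset Strict Implicit. Unset Printing Implicit Defensive.

(** * Lebesgue integrals on the line *)

Section integrals.
Context {R : realType}.
Notation mu := (@lebesgue_measure R).

(** The transition function is a supremum of Picard iterates, so nothing of a Markov semigroup is
    given. Cutting a path at an intermediate time yields only P_{t+s} <= P_t P_s; equality comes
    from applying this to g and to 1 - g, whose values add up to 1 once mass is conserved.
    Non-explosion is thus what makes a semigroup available at all. The weights of V are such that
    every move of a mass u y_i lowers V by exactly u y_i; the rate y_i and the mean 1/2 of u give -
    y_i^2 / 2, while the leader adds n - 1 times the mean 1 of theta. The quadratic drift brings the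
    chain down from arbitrarily large states in bounded time, so that the minorization need not be
    restricted to a small set. The minorizing measure is never constructed: for 0 <= f <= 1, one of
    f and 1 - f has an integral over the cube of at least half its volume, and a uniform lower bound
    on either one shrinks the oscillation of f. The error (1 - eps)^k does not depend on the set,
    which gives countable additivity of the limit without any compactness or Feller property. *)

Lemma measurable_fun_integral_segment d (X : measurableType d) (a : X -> R)
    (f : X -> R -> \bar R) :
  measurable_fun [set: X] a ->
  measurable_fun setT (fun p : X * R => f p.1 p.2) ->
  (forall x s, (0 <= f x s)%E) ->
  measurable_fun [set: X]
    (fun x => \int[mu]_(s in `[0%R, a x]) f x s)%E.
Proof.
move=> ma mf f0.
pose g (p : X * R) := if (0 <= p.2) && (p.2 <= a p.1) then f p.1 p.2 else 0%E.
rewrite [X in measurable_fun _ X](_ : _ = fubini_F mu g).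
  apply: measurable_fun_fubini_tonelli_F => [|p]; last by rewrite /g; case: ifP.
  apply: measurable_fun_ifT => //.
  apply: measurable_and; apply: measurable_fun_ler => //.
  by apply: measurableT_comp ma _.
apply/funext => x; rewrite /fubini_F [LHS]integral_mkcond; apply: eq_integral => s _.
rewrite /patch /g /=; congr (if _ then _ else _).
by apply/idP/idP => [|h]; rewrite ?inE /= in_itv.
Qed.

(** The image of Lebesgue measure under x -> a x + b, scaled by |a|, agrees with it on half-open
    intervals, hence everywhere. Slope 1 shifts time in the backward equation; a negative slope
    reads a uniform jump as Lebesgue measure on what remains of a gap. *)
Lemma ge0_integral_affine (a b : R) (f : R -> \bar R) : a != 0 ->
  measurable_fun [set: R] f -> (forall x, (0 <= f x)%E) ->
  (\int[mu]_x f x = `|a|%:E * \int[mu]_x f (a * x + b)%R)%E.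
Proof.
move=> a0 mf f0.
have mphi : measurable_fun [set: measurableTypeR R]
    (fun x : measurableTypeR R => (a * x + b)%R : measurableTypeR R).
  by apply: measurable_funD => //; apply: measurable_funM.
pose P := measure_function_pushforward__canonical__measure_function_Measure mu mphi.
pose nu := mscale (NngNum (normr_ge0 a)) P.
rewrite [LHS](eq_measure_integral nu); last first.
  move=> A mA _; apply: (lebesgue_measure_unique (mu := nu)); last exact: mA.
  move=> _ [[u v] _ <-] /=; rewrite /nu /mscale /= /pushforward.
  have [a_gt0|a_le0] := ltP 0 a.
    rewrite (_ : _ @^-1` _ = `]((u - b) / a), ((v - b) / a)]%classic); last first.
      apply/seteqP; split => x /=; rewrite !in_itv /= ltr_pdivrMr// ler_pdivlMr//;
        by move=> /andP[? ?]; apply/andP; split; lra.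
    rewrite !lebesgue_measure_itv /= !lte_fin ltr_pM2r ?invr_gt0// ltrD2r.
    rewrite gtr0_norm//; case: ifP => _; last by rewrite mule0.
    by rewrite -!EFinD -EFinM; congr EFin; field.
  have a_lt0 : a < 0 by rewrite lt_neqAle a0.
  (* A negative slope exchanges the open and the closed end; the length is the same. *)
  rewrite (_ : _ @^-1` _ = `[((v - b) / a), ((u - b) / a)[%classic); last first.
    apply/seteqP; split => x /=; rewrite !in_itv /= ler_ndivrMr// ltr_ndivlMr//;
      by move=> /andP[? ?]; apply/andP; split; lra.
  rewrite !lebesgue_measure_itv /= !lte_fin ltr_nM2r ?invr_lt0// ltrD2r.
  rewrite ltr0_norm//; case: ifP => _; last by rewrite mule0.
  by rewrite -!EFinD -EFinM; congr EFin; field.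
by rewrite ge0_integral_mscale// ge0_integral_pushforward.
Qed.

End integrals.

(** * Picard iterates of the backward equation *)

Definition mpos (R : realType) d (T : measurableType d) (g : T -> \bar R) :=
  measurable_fun setT g /\ forall y, (0 <= g y)%E.

Definition mpos2 (R : realType) d (T : measurableType d) (u : R -> T -> \bar R) :=
  measurable_fun setT (fun p : R * T => u p.1 p.2) /\
  forall t y, (0 <= u t y)%E.

(** [jk_mfun] is required for time-dependent integrands because the backward equation integrates
    [u (t - s)], so that measurability is needed jointly in time and state. *)
Record jumpKernel (R : realType) d (T : measurableType d) := JumpKernel {
  jk :> T -> {measure set T -> \bar R} ;
  jrate : T -> R ;
  jrate_ge0 : forall y, 0 <= jrate y ;
  jrate_mfun : measurable_fun setT jrate ;
  jkT : forall y, jk y setT = (jrate y)%:E ;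
  jk_mfun : forall u : R -> T -> \bar R, mpos2 u ->
    measurable_fun setT (fun p : R * T => \int[jk p.2]_z u p.1 z)%E
}.

Section jump_process.
Context {R : realType} {d} {T : measurableType d}.
Variable K : jumpKernel R T.
Notation mu := (@lebesgue_measure R).
Implicit Types (g h : T -> \bar R) (u v : R -> T -> \bar R).
Local Open Scope ereal_scope.

Definition dec (y : T) (s : R) : R := expR (- (jrate K y * s)).

Definition jint g (y : T) := \int[K y]_z g z.

(** First-jump decomposition: wait at y until time s, jump, then run u for the remaining time t -
    s. *)
Definition step u (t : R) (y : T) :=
  \int[mu]_(s in `[0%R, t]) ((dec y s)%:E * jint (u (t - s)%R) y).

(** This is the expectation of g at time t, started at y, on the event that at most k jumps occur up
    to t. *)
Fixpoint picard (k : nat) g (t : R) (y : T) : \bar R :=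
  (dec y t)%:E * g y +
  (if k is k'.+1 then step (picard k' g) t y else 0).

Definition trans (t : R) g (y : T) := ereal_sup (range (fun k => picard k g t y)).

Lemma dec_ge0 y s : (0 <= (dec y s)%:E)%E.
Proof. by rewrite lee_fin expR_ge0. Qed.

Lemma dec_mfun2 : measurable_fun setT (fun p : R * T => dec p.2 p.1).
Proof.
apply: measurableT_comp => //; apply: measurableT_comp => //.
by apply: measurable_funM => //; apply: measurableT_comp; first exact: jrate_mfun.
Qed.

Lemma mpos2_mpos u t : mpos2 u -> mpos (u t).
Proof.
move=> [mu_ u0]; split => //.
apply: (measurableT_comp mu_ (g := fun y : T => (t, y))).
exact: measurable_fun_pair.
Qed.

Lemma mpos2_shift u (s : R) : mpos2 u -> mpos2 (fun t => u (t + s)%R).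
Proof.
move=> [mu_ u0]; split => //.
apply: (measurableT_comp mu_ (g := fun p : R * T => ((p.1 + s)%R, p.2))).
apply: measurable_fun_pair => //.
by apply: measurable_funD.
Qed.

Lemma mpos2_cst g : mpos g -> mpos2 (fun=> g).
Proof. by move=> [mg g0]; split => //; exact: measurableT_comp. Qed.

Lemma jint_mpos2 u : mpos2 u -> mpos2 (fun t => jint (u t)).
Proof.
move=> mu2; split; first exact: jk_mfun.
by move=> t y; apply: integral_ge0 => z _; case: mu2.
Qed.

Lemma jint_mpos g : mpos g -> mpos (jint g).
Proof. by move=> /mpos2_cst /jint_mpos2 /(mpos2_mpos (0%R)). Qed.

Lemma le_jint g h y : mpos g -> mpos h -> (forall z, g z <= h z) ->
  jint g y <= jint h y.
Proof. by move=> [mg g0] [mh h0] gh; apply: ge0_le_integral. Qed.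

Lemma jintD g h y : mpos g -> mpos h ->
  jint (fun z => g z + h z) y = jint g y + jint h y.
Proof. by move=> [mg g0] [mh h0]; apply: ge0_integralD. Qed.

Lemma jintZ (c : R) g y : (0 <= c)%R -> mpos g ->
  jint (fun z => c%:E * g z) y = c%:E * jint g y.
Proof. by move=> c0 [mg g0]; apply: ge0_integralZl. Qed.

Lemma jint_cst (c : R) y : (0 <= c)%R -> jint (fun=> c%:E) y = (c * jrate K y)%:E.
Proof. by move=> c0; rewrite /jint integral_cst// jkT EFinM. Qed.

Lemma step_mfun u y t : mpos2 u ->
  measurable_fun setT (fun s : R => (dec y s)%:E * jint (u (t - s)%R) y).
Proof.
move=> /jint_mpos2[mj _]; apply: emeasurable_funM.
  apply: measurableT_comp => //; apply: measurableT_comp => //.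
  by apply: measurableT_comp => //; exact: measurable_funM.
apply: (measurableT_comp mj (g := fun s : R => ((t - s)%R, y))).
by apply: measurable_fun_pair => //; exact: measurable_funB.
Qed.

Lemma step_arg_ge0 u y t s : mpos2 u -> 0 <= (dec y s)%:E * jint (u (t - s)%R) y.
Proof. by move=> /jint_mpos2[_ j0]; rewrite mule_ge0// dec_ge0. Qed.

Lemma step_mpos2 u : mpos2 u -> mpos2 (step u).
Proof.
move=> mu2; split; last first.
  by move=> t y; apply: integral_ge0 => s _; exact: step_arg_ge0.
apply: (@measurable_fun_integral_segment R _ _ fst
  (fun (p : R * T) s => (dec p.2 s)%:E * jint (u (p.1 - s)%R) p.2)) => //.
  apply: emeasurable_funM.
    apply: measurableT_comp => //.
    apply: (measurableT_comp dec_mfun2 (g := fun p : (R * T) * R => (p.2, p.1.2))).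
    apply: measurable_fun_pair => //.
    exact: measurableT_comp.
  have [mj _] := jint_mpos2 mu2.
  apply: (measurableT_comp mj (g := fun p : (R * T) * R => ((p.1.1 - p.2)%R, p.1.2))).
  apply: measurable_fun_pair; last exact: measurableT_comp.
  by apply: measurable_funB => //; exact: measurableT_comp.
by move=> p s; exact: step_arg_ge0.
Qed.

Lemma le_step u v t y : mpos2 u -> mpos2 v ->
  (forall s z, (0 <= s <= t)%R -> u s z <= v s z) -> step u t y <= step v t y.
Proof.
move=> mu2 mv2 uv; apply: ge0_le_integral => //.
- by move=> s _; exact: step_arg_ge0.
- by apply: measurable_funTS; exact: step_mfun.
- by apply: measurable_funTS; exact: step_mfun.
- move=> s /=; rewrite in_itv/= => /andP[s0 st].
  apply: lee_wpmul2l; first exact: dec_ge0.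
  apply: le_jint => //; [exact: mpos2_mpos|exact: mpos2_mpos|move=> z].
  by apply: uv; rewrite subr_ge0 st gerBl s0.
Qed.

Lemma stepD u v t y : mpos2 u -> mpos2 v ->
  step (fun s z => u s z + v s z) t y = step u t y + step v t y.
Proof.
move=> mu2 mv2; rewrite /step -ge0_integralD//.
- apply: eq_integral => s _.
  rewrite jintD; [|exact: mpos2_mpos|exact: mpos2_mpos].
  by rewrite ge0_muleDr//; [case: (jint_mpos2 mu2)|case: (jint_mpos2 mv2)].
- by move=> s _; exact: step_arg_ge0.
- by apply: measurable_funTS; exact: step_mfun.
- by move=> s _; exact: step_arg_ge0.
- by apply: measurable_funTS; exact: step_mfun.
Qed.

Lemma stepZ (c : R) u t y : (0 <= c)%R -> mpos2 u ->
  step (fun s z => c%:E * u s z) t y = c%:E * step u t y.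
Proof.
move=> c0 mu2; rewrite /step -ge0_integralZl//.
- apply: eq_integral => s _.
  by rewrite jintZ//; [rewrite muleCA|exact: mpos2_mpos].
- by apply: measurable_funTS; exact: step_mfun.
- by move=> s _; exact: step_arg_ge0.
Qed.

Lemma step_nneseries (F : nat -> R -> T -> \bar R) t y : (forall i, mpos2 (F i)) ->
  step (fun s z => \sum_(0 <= i <oo) F i s z) t y = \sum_(0 <= i <oo) step (F i) t y.
Proof.
move=> mF; rewrite /step -integral_nneseries//.
- apply: eq_integral => s _; rewrite nneseriesZl; last first.
    by move=> i _; case: (jint_mpos2 (mF i)).
  congr (_ * _); apply: integral_nneseries => //.
    by move=> i; case: (mpos2_mpos (t - s)%R (mF i)).
  by move=> i z _; case: (mF i).
- by move=> i; apply: measurable_funTS; exact: step_mfun.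
- by move=> i s _; exact: step_arg_ge0.
Qed.

Lemma decD y s t : dec y (s + t) = (dec y s * dec y t)%R.
Proof. by rewrite /dec mulrDr opprD expRD. Qed.

Lemma dec0 y : dec y 0 = 1%R.
Proof. by rewrite /dec mulr0 oppr0 expR0. Qed.

(** Lack of memory: either no jump occurs up to t, with probability [dec y t], and the waiting
    starts afresh with s left, or the first jump occurs before t and s is added to the time
    remaining after it. *)
Lemma step_split u s t y : (0 <= s)%R -> (0 <= t)%R -> mpos2 u ->
  step u (t + s) y = (dec y t)%:E * step u s y + step (fun a => u (a + s)%R) t y.
Proof.
move=> s0 t0 mu2; rewrite /step.
pose f r := (dec y r)%:E * jint (u (t + s - r)%R) y.
have mf : measurable_fun setT f by exact: step_mfun.
have f0 r : 0 <= f r by exact: step_arg_ge0.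
have -> : [set` `[0%R, (t + s)%R]] = [set` `[0%R, t]] `|` [set` `]t, (t + s)%R]].
  by rewrite -itv_bndbnd_setU// bnd_simp lerDl.
rewrite ge0_integral_setU//; last 3 first.
- exact: measurable_funTS.
- by move=> x _; exact: f0.
- apply/disj_setPS => r [] /=; rewrite !in_itv/= => /andP[_ rt] /andP[tr _].
  by move: (lt_le_trans tr rt); rewrite ltxx.
rewrite addeC; congr (_ + _); last first.
  by apply: eq_integral => r _; congr (_ * jint (u _) _); rewrite addrAC.
rewrite -ge0_integralZl//; last 3 first.
- by apply: measurable_funTS; exact: step_mfun.
- by move=> r _; exact: step_arg_ge0.
- exact: dec_ge0.
transitivity (\int[mu]_(r in `[t, (t + s)%R]) f r).
  rewrite -[RHS]integral_itv_obnd_cbnd//.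
  exact: measurable_funTS.
rewrite [LHS]integral_mkcond [RHS]integral_mkcond.
rewrite (@ge0_integral_affine _ 1 t) ?oner_neq0//; last 2 first.
- by apply/(measurable_restrictT _ _).1 => //; exact: measurable_funTS.
- by move=> r; rewrite erestrict_ge0.
rewrite normr1 mul1e; apply: eq_integral => r _.
rewrite /patch !mem_setE !in_itv /= mul1r lerDr addrC lerD2l.
case: ifP => // _; rewrite /f decD EFinM muleA; congr (_ * jint (u _) _).
by ring.
Qed.

Lemma picard_mpos2 k g : mpos g -> mpos2 (picard k g).
Proof.
move=> [mg g0].
have m0 : mpos2 (fun t y => (dec y t)%:E * g y).
  split; last by move=> t y; rewrite mule_ge0// dec_ge0.
  apply: emeasurable_funM; first by apply: measurableT_comp dec_mfun2.
  exact: measurableT_comp.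
elim: k => [|k [mk k0]] /=; first by under eq_fun do under eq_fun do rewrite adde0.
have [ms s0] := step_mpos2 (conj mk k0); case: m0 => m0 p0; split.
  exact: emeasurable_funD.
by move=> t y; rewrite adde_ge0.
Qed.

Lemma picard_mpos k g t : mpos g -> mpos (picard k g t).
Proof. by move=> mg; apply/mpos2_mpos/picard_mpos2. Qed.

Lemma le_picard k g h t y : mpos g -> mpos h -> (forall z, g z <= h z) ->
  picard k g t y <= picard k h t y.
Proof.
move=> mg mh gh; elim: k t y => [|k IH] t y /=.
  by rewrite !adde0 lee_wpmul2l// dec_ge0.
apply: leeD; first by rewrite lee_wpmul2l// dec_ge0.
by apply: le_step => [||s z _]; [exact: picard_mpos2|exact: picard_mpos2|exact: IH].
Qed.

Lemma picard_leS k g t y : mpos g -> picard k g t y <= picard k.+1 g t y.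
Proof.
move=> mg; elim: k t y => [|k IH] t y.
  by rewrite /= adde0 leeDl//; case: (step_mpos2 (picard_mpos2 0 mg)).
by apply: leeD => //; apply: le_step => [||s z _];
  [exact: (picard_mpos2 k mg)|exact: (picard_mpos2 k.+1 mg)|exact: IH].
Qed.

Lemma picard_homo g t y : mpos g ->
  {homo (fun k => picard k g t y) : k l / (k <= l)%N >-> k <= l}.
Proof. by move=> mg; apply/nondecreasing_seqP => k; exact: picard_leS. Qed.

Lemma picardD k g h t y : mpos g -> mpos h ->
  picard k (fun z => g z + h z) t y = picard k g t y + picard k h t y.
Proof.
move=> mg mh; have [_ g0] := mg; have [_ h0] := mh.
elim: k t y => [|k IH] t y /=; first by rewrite !adde0 ge0_muleDr.
rewrite ge0_muleDr//.
have -> : picard k (fun z => g z + h z) = fun s z => picard k g s z + picard k h s z.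
  by apply/funext => s; apply/funext => z; exact: IH.
rewrite (stepD t y (picard_mpos2 k mg) (picard_mpos2 k mh)).
exact: addeACA.
Qed.

Lemma picardZ k (c : R) g t y : (0 <= c)%R -> mpos g ->
  picard k (fun z => c%:E * g z) t y = c%:E * picard k g t y.
Proof.
move=> c0 mg; have [_ g0] := mg.
elim: k t y => [|k IH] t y /=; first by rewrite !adde0 muleCA.
have -> : picard k (fun z => c%:E * g z) = fun s z => c%:E * picard k g s z.
  by apply/funext => s; apply/funext => z; exact: IH.
rewrite (stepZ t y c0 (picard_mpos2 k mg)) muleCA -ge0_muleDr//.
  by rewrite mule_ge0// dec_ge0.
by case: (step_mpos2 (picard_mpos2 k mg)).
Qed.

End jump_process.

(** * Semigroup and supersolutions *)

Local Opaque step jint dec.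

Section semigroup.
Context {R : realType} {d} {T : measurableType d}.
Variable K : jumpKernel R T.
Notation mu := (@lebesgue_measure R).
Implicit Types (g h : T -> \bar R) (u v : R -> T -> \bar R).
Local Open Scope ereal_scope.

Lemma picard_shift k g s t y : (0 <= s)%R -> (0 <= t)%R -> mpos g ->
  picard K k.+1 g (t + s) y =
  (dec K y t)%:E * picard K k.+1 g s y +
  step K (fun a => picard K k g (a + s)%R) t y.
Proof.
move=> s0 t0 mg; have mk := picard_mpos2 K k mg; have [_ g0] := mg.
rewrite /= step_split// decD EFinM addeA; congr (_ + _).
rewrite [RHS]ge0_muleDr; first by rewrite muleA.
  by rewrite mule_ge0// dec_ge0.
by case: (step_mpos2 K mk).
Qed.

(** At most k jumps during t + s means at most k during each of the two periods. The converse fails,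
    whence only an inequality. *)
Lemma picard_add_le k g s t y : (0 <= s)%R -> (0 <= t)%R -> mpos g ->
  picard K k g (t + s) y <= picard K k (picard K k g s) t y.
Proof.
move=> s0 + mg; elim: k t y => [|k IH] t y t0.
  by rewrite /= !adde0 decD EFinM muleA.
rewrite picard_shift//; apply: leeD => //.
have mgs := picard_mpos K k s mg.
apply: (@le_trans _ _ (step K (picard K k (picard K k g s)) t y)).
  apply: le_step => [||a z /andP[a0 _]]; last exact: IH.
    exact/mpos2_shift/picard_mpos2.
  exact: picard_mpos2.
apply: le_step => [||a z _]; [exact: picard_mpos2| |].
  exact/picard_mpos2/(picard_mpos K k.+1).
apply: le_picard => [||w]; [by []| |exact: picard_leS].
exact: (picard_mpos K k.+1).
Qed.

Lemma picard_le_trans k g t y : picard K k g t y <= trans K t g y.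
Proof. by apply: ereal_sup_ubound; exists k. Qed.

Lemma trans_le_ub g t y a : (forall k, picard K k g t y <= a) -> trans K t g y <= a.
Proof. by move=> h; apply: ge_ereal_sup => _ [k _ <-]. Qed.

Lemma trans_cvg g t y : mpos g -> picard K k g t y @[k --> \oo] --> trans K t g y.
Proof. by move=> mg; apply: ereal_nondecreasing_cvgn; exact: picard_homo. Qed.

Lemma trans_mpos t g : mpos g -> mpos (trans K t g).
Proof.
move=> mg; split; last first.
  move=> y; apply: le_trans (picard_le_trans 0 g t y).
  by case: (picard_mpos K 0 t mg).
apply: (emeasurable_fun_cvg (fun k => picard K k g t)).
  by move=> k; case: (picard_mpos K k t mg).
by move=> y _; exact: trans_cvg.
Qed.

Lemma le_transP t g h y : mpos g -> mpos h -> (forall z, g z <= h z) ->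
  trans K t g y <= trans K t h y.
Proof.
move=> mg mh gh; apply: trans_le_ub => k.
by apply: le_trans (picard_le_trans k h t y); exact: le_picard.
Qed.

Lemma transD t g h y : mpos g -> mpos h ->
  trans K t (fun z => g z + h z) y = trans K t g y + trans K t h y.
Proof.
move=> mg mh; have [_ g0] := trans_mpos t mg; have [_ h0] := trans_mpos t mh.
have mgh : mpos (fun z => g z + h z).
  case: mg mh => mg ? [mh ?]; split; first exact: emeasurable_funD.
  by move=> z; rewrite adde_ge0.
apply: (cvg_unique _ (trans_cvg (t := t) (y := y) mgh)) => //.
have -> : (fun k => picard K k (fun z => g z + h z) t y) =
    (fun k => picard K k g t y + picard K k h t y).
  by apply/funext => k; exact: picardD.
by apply: cvgeD; [by apply: ge0_adde_def; rewrite inE|exact: trans_cvg|exact: trans_cvg].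
Qed.

Lemma transZ t (c : R) g y : (0 <= c)%R -> mpos g ->
  trans K t (fun z => c%:E * g z) y = c%:E * trans K t g y.
Proof.
move=> c0 mg; have [mg_ g0] := mg.
have mcg : mpos (fun z => c%:E * g z).
  by split; [exact: emeasurable_funM|move=> z; rewrite mule_ge0].
apply: (cvg_unique _ (trans_cvg (t := t) (y := y) mcg)) => //.
have -> : (fun k => picard K k (fun z => c%:E * g z) t y) =
    (fun k => c%:E * picard K k g t y).
  by apply/funext => k; exact: picardZ.
by apply: cvgeZl => //; exact: trans_cvg.
Qed.

Lemma trans_add_le s t g y : (0 <= s)%R -> (0 <= t)%R -> mpos g ->
  trans K (t + s) g y <= trans K t (trans K s g) y.
Proof.
move=> s0 t0 mg; apply: trans_le_ub => k.
apply: le_trans (picard_add_le k y s0 t0 mg) _.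
apply: le_trans (picard_le_trans k _ t y).
apply: le_picard; [exact: picard_mpos|exact: trans_mpos|].
by move=> z; exact: picard_le_trans.
Qed.

Lemma mpos_nneseries (G : nat -> T -> \bar R) : (forall i, mpos (G i)) ->
  mpos (fun z => \sum_(0 <= i <oo) G i z).
Proof.
move=> mG; split; last first.
  by move=> z; apply: nneseries_ge0 => i _ _; case: (mG i).
apply: ge0_emeasurable_sum => i *; by case: (mG i).
Qed.

Lemma mpos_sum (G : nat -> T -> \bar R) n : (forall i, mpos (G i)) ->
  mpos (fun z => \sum_(0 <= i < n) G i z).
Proof.
move=> mG; split; last by move=> z; apply: sume_ge0 => i _; case: (mG i).
by apply: emeasurable_sum => i; case: (mG i).
Qed.

Lemma trans_sum t (G : nat -> T -> \bar R) n y : (forall i, mpos (G i)) ->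
  trans K t (fun z => \sum_(0 <= i < n) G i z) y = \sum_(0 <= i < n) trans K t (G i) y.
Proof.
move=> mG; elim: n => [|n IH].
  rewrite big_geq//; under eq_fun do rewrite big_geq// -(mul0e 1).
  by rewrite transZ ?mul0e//; split.
rewrite big_nat_recr//= -IH -transD; [|exact: mpos_sum|exact: mG].
by congr (trans _ _ _ _); apply/funext => z; rewrite big_nat_recr.
Qed.

Lemma picard_nneseries k t (G : nat -> T -> \bar R) y : (forall i, mpos (G i)) ->
  picard K k (fun z => \sum_(0 <= i <oo) G i z) t y =
  \sum_(0 <= i <oo) picard K k (G i) t y.
Proof.
move=> mG; have G0 i z : 0 <= G i z by case: (mG i).
elim: k t y => [|k IH] t y /=.
  rewrite adde0 -nneseriesZl; last by move=> i _; exact: G0.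
  by apply: eq_eseriesr => i _; rewrite adde0.
have -> : picard K k (fun z => \sum_(0 <= i <oo) G i z) =
    fun s z => \sum_(0 <= i <oo) picard K k (G i) s z.
  by apply/funext => s; apply/funext => z; exact: IH.
rewrite step_nneseries; last by move=> i; exact: picard_mpos2.
rewrite -nneseriesZl; last by move=> i _; exact: G0.
rewrite -nneseriesD// => i _ _; first by rewrite mule_ge0// dec_ge0.
by case: (step_mpos2 K (picard_mpos2 K k (mG i))).
Qed.

Lemma trans_nneseries t (G : nat -> T -> \bar R) y : (forall i, mpos (G i)) ->
  trans K t (fun z => \sum_(0 <= i <oo) G i z) y = \sum_(0 <= i <oo) trans K t (G i) y.
Proof.
move=> mG; apply/eqP; rewrite eq_le; apply/andP; split.
  apply: trans_le_ub => k; rewrite picard_nneseries//.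
  apply: lee_nneseries => i *; first by case: (picard_mpos K k t (mG i)).
  exact: picard_le_trans.
apply: lime_le.
  by apply: is_cvg_nneseries => i *; case: (trans_mpos t (mG i)).
near=> n; rewrite -trans_sum//; apply: le_transP.
- exact: mpos_sum.
- exact: mpos_nneseries.
- by move=> z; apply: nneseries_lim_ge => i *; case: (mG i).
Unshelve. all: by end_near. Qed.

Lemma trans0 g y : mpos g -> g y <= trans K 0 g y.
Proof.
move=> mg; apply: le_trans (picard_le_trans 0 g 0 y).
by rewrite /= adde0 dec0 mul1e.
Qed.

Lemma trans_le_super g u t y : mpos g -> mpos2 u ->
  (forall t y, (0 <= t)%R -> (dec K y t)%:E * g y + step K u t y <= u t y) ->
  (0 <= t)%R -> trans K t g y <= u t y.
Proof.
move=> mg mu2 su t0; apply: trans_le_ub => k.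
elim: k t y t0 => [|k IH] t y t0 /=; apply: le_trans (su t y t0).
  by rewrite adde0 leeDl//; case: (step_mpos2 K mu2).
apply: leeD => //; apply: le_step => //; first exact: picard_mpos2.
by move=> s z /andP[s0 _]; exact: IH.
Qed.

(** The integrand is the derivative of s -> - [dec K y s * H (t - s)]. This trades the integral form
    of the backward equation for a pointwise differential condition. *)
Lemma dec_FTC (y : T) (H H' : R -> R) (t : R) : (0 <= t)%R ->
  (forall s : R, (0 <= s)%R -> is_derive s (1:R)%R H (H' s)) ->
  (forall s : R, (0 <= s)%R -> {for s, continuous H'}) ->
  (dec K y t * H 0%R)%:E + \int[mu]_(s in `[0%R, t])
    (dec K y s * (jrate K y * H (t - s) + H' (t - s)))%:E = (H t)%:E.
Proof.
(* The fundamental theorem needs a nondegenerate interval, so t = 0 is treated apart. *)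
rewrite le_eqVlt => /predU1P[<-|t0] dH cH.
  by rewrite set_itv1 integral_set1 adde0 dec0 mul1r.
pose F s := (- (dec K y s * H (t - s)))%R.
have dF s : (0 <= s <= t)%R ->
    is_derive s (1:R)%R F (dec K y s * (jrate K y * H (t - s) + H' (t - s)))%R.
  move=> /andP[s0 st].
  have h1 : is_derive s (1:R)%R (fun s => H (t - s)%R) (- H' (t - s))%R.
    have := dH (t - s)%R; rewrite subr_ge0 => /(_ st) dHts.
    have dl : is_derive s (1:R)%R (fun s => t - s)%R (-1)%R.
      by apply: is_derive_eq; rewrite add0r mul1r.
    have := is_derive1_comp (f := H) (g := fun s : R => (t - s)%R) dHts dl.
    by rewrite mulrN1.
  have h2 : is_derive s (1:R)%R (dec K y) (- jrate K y * dec K y s)%R.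
    have dl : is_derive s (1:R)%R (fun s => - (jrate K y * s))%R (- jrate K y)%R.
      by apply: is_derive_eq; rewrite /GRing.scale/= mulr1.
    have := is_derive1_comp (f := expR)
      (g := fun s : R => (- (jrate K y * s))%R) (is_derive_expR _) dl.
    by rewrite mulrC.
  apply: is_derive_eq; rewrite /GRing.scale/=; ring.
have cF s : (0 <= s <= t)%R -> {for s, continuous F}.
  move=> /dF dFs; apply: differentiable_continuous; apply/derivable1_diffP.
  exact: ex_derive.
rewrite (continuous_FTC2 (F := F) t0).
- by rewrite /F dec0 subr0 subrr -EFinB -EFinD; congr EFin; ring.
- apply: continuous_in_subspaceT => s; rewrite inE/= in_itv/= => /andP[s0 st].
  have ts0 : (0 <= t - s)%R by rewrite subr_ge0.
  have ct : {for s, continuous (fun s => t - s)%R}.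
    by apply: cvgB; [exact: cvg_cst|exact: cvg_id].
  have cHs : {for s, continuous (fun s => H (t - s)%R)}.
    apply: (continuous_comp (f := fun s => (t - s)%R) (g := H)) => //.
    apply: differentiable_continuous; apply/derivable1_diffP.
    by have := dH _ ts0 => dHts; exact: ex_derive.
  have cHs' : {for s, continuous (fun s => H' (t - s)%R)}.
    by apply: (continuous_comp (f := fun s => (t - s)%R) (g := H')) => //; exact: cH.
  have cd : {for s, continuous (dec K y)}.
    apply: (continuous_comp (f := fun s => (- (jrate K y * s))%R) (g := expR)).
      by apply: cvgN; apply: cvgM; [exact: cvg_cst|exact: cvg_id].
    exact: continuous_expR.
  apply: cvgM => //; apply: cvgD => //.
  by apply: cvgM => //; exact: cvg_cst.
- split.
  + move=> s; rewrite in_itv/= => /andP[s0 st].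
    by have := dF s; rewrite !ltW// => /(_ isT) dFs; exact: ex_derive.
  + by apply: cvg_at_right_filter; apply: cF; rewrite lexx ltW.
  + by apply: cvg_at_left_filter; apply: cF; rewrite lexx ltW.
- move=> s; rewrite in_itv/= => /andP[s0 st].
  by have := dF s; rewrite !ltW// => /(_ isT) dFs; rewrite derive1E derive_val.
Unshelve. all: by end_near. Qed.

End semigroup.

(** * Non-explosion *)

Local Opaque step jint dec.

Section conservative.
Context {R : realType} {d} {T : measurableType d}.
Variable K : jumpKernel R T.
Notation mu := (@lebesgue_measure R).
Implicit Types (g h : T -> \bar R) (u v : R -> T -> \bar R).
Local Open Scope ereal_scope.

Lemma mpos_cst (c : R) : (0 <= c)%R -> mpos (fun _ : T => c%:E).
Proof. by move=> c0; split. Qed.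

Lemma mpos_EFin (f : T -> R) : measurable_fun setT f -> (forall y, 0 <= f y)%R ->
  mpos (EFin \o f).
Proof.
by move=> mf f0; split; [exact/measurable_EFinP|move=> y; rewrite lee_fin].
Qed.

Lemma mposD g h : mpos g -> mpos h -> mpos (fun z => g z + h z).
Proof.
move=> [mg g0] [mh h0]; split; first exact: emeasurable_funD.
by move=> z; rewrite adde_ge0.
Qed.

Lemma mposZ (c : R) g : (0 <= c)%R -> mpos g -> mpos (fun z => c%:E * g z).
Proof.
by move=> c0 [mg g0]; split; [exact: emeasurable_funM|move=> z; rewrite mule_ge0].
Qed.

Lemma step_FTC u (y : T) (H H' : R -> R) (t : R) : (0 <= t)%R -> mpos2 u ->
  (forall s : R, (0 <= s)%R -> is_derive s (1:R)%R H (H' s)) ->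
  (forall s : R, (0 <= s)%R -> {for s, continuous H'}) ->
  (forall s : R, (0 <= s)%R -> jint K (u s) y <= (jrate K y * H s + H' s)%:E) ->
  (dec K y t * H 0%R)%:E + step K u t y <= (H t)%:E.
Proof.
move=> t0 mu2 dH cH uH; rewrite -(dec_FTC K y t0 dH cH); apply: leeD => //.
have H0 s : (0 <= s <= t)%R ->
    (dec K y s)%:E * jint K (u (t - s)%R) y <=
    (dec K y s * (jrate K y * H (t - s) + H' (t - s)))%:E.
  move=> /andP[s0 st]; rewrite EFinM; apply: lee_wpmul2l; first exact: dec_ge0.
  by apply: uH; rewrite subr_ge0.
apply: ge0_le_integral => //.
- by move=> s _; exact: step_arg_ge0.
- by apply: measurable_funTS; exact: step_mfun.
- apply/measurable_EFinP.
  have ct s : {for s, continuous (fun s : R => t - s)%R}.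
    by apply: cvgB; [exact: cvg_cst|exact: cvg_id].
  apply: measurable_funM.
    have md := dec_mfun2 K.
    apply: measurable_funTS.
    apply: (measurableT_comp md (g := fun s : R => (s, y))).
    exact: measurable_fun_pair.
  apply: (subspace_continuous_measurable_fun (D := `[0%R, t]%classic)) => //.
  apply: continuous_in_subspaceT => s; rewrite inE/= in_itv/= => /andP[s0 st].
  have ts0 : (0 <= t - s)%R by rewrite subr_ge0.
  apply: cvgD.
    apply: cvgM; first exact: cvg_cst.
    apply: (continuous_comp (f := fun s => (t - s)%R) (g := H)); first exact: ct.
    apply: differentiable_continuous; apply/derivable1_diffP.
    by have := dH _ ts0 => dHts; exact: ex_derive.
  apply: (continuous_comp (f := fun s => (t - s)%R) (g := H')); first exact: ct.
  exact: cH.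
Qed.

(** As the generator is [jint] minus multiplication by [jrate], the premise on [jint] says L u <=
    du/ds. H is kept apart from u because u must be nonnegative at all real times, whereas the
    differential condition concerns only s >= 0. *)
Lemma trans_le_FTC g u (H H' : T -> R -> R) t y : mpos g -> mpos2 u ->
  (forall z (s : R), (0 <= s)%R -> u s z = (H z s)%:E) ->
  (forall z (s : R), (0 <= s)%R -> is_derive s (1:R)%R (H z) (H' z s)) ->
  (forall z (s : R), (0 <= s)%R -> {for s, continuous (H' z)}) ->
  (forall z, g z <= u 0%R z) ->
  (forall z (s : R), (0 <= s)%R ->
     jint K (u s) z <= (jrate K z * H z s + H' z s)%:E) ->
  (0 <= t)%R -> trans K t g y <= u t y.
Proof.
move=> mg mu2 uH dH cH gu HH t0.
apply: trans_le_super => // {t0}t {}y t0; rewrite (uH y t)//.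
apply: le_trans (step_FTC t0 mu2 (dH y) (cH y) (HH y)).
by apply: leeD => //; rewrite EFinM -uH// lee_wpmul2l// dec_ge0.
Qed.

Lemma step_cst1 (t : R) y : (0 <= t)%R ->
  (dec K y t)%:E + step K (fun _ _ => 1) t y = 1.
Proof.
move=> t0.
have := @dec_FTC _ _ _ K y (fun=> 1%R) (fun=> 0%R) t t0.
rewrite mulr1 => FTC; rewrite -[RHS]FTC.
- congr (_ + _); apply: eq_integral => s _.
  by rewrite jint_cst// mul1r mulr1 addr0 EFinM.
- by move=> s _; exact: cvg_cst.
Qed.

Lemma picard1_le1 k (t : R) y : (0 <= t)%R -> picard K k (fun=> 1) t y <= 1.
Proof.
move=> t0; apply: le_trans (picard_le_trans K k (fun=> 1) t y) _.
apply: (trans_le_super (u := fun _ _ => 1)) => //.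
by move=> {t0}t {}y t0; rewrite mule1 step_cst1.
Qed.

Lemma trans1_le1 (t : R) y : (0 <= t)%R -> trans K t (fun=> 1) y <= 1.
Proof. by move=> t0; apply: trans_le_ub => k; exact: picard1_le1. Qed.

(* V + C t dominates the expected number of jumps up to time t, and k times the
   probability of more than k jumps is at most that expectation. *)
Lemma nonexplosion (V : T -> R) (C : R) (t : R) y :
  measurable_fun setT V -> (forall z, 0 <= V z)%R -> (0 <= C)%R ->
  (forall z, jint K (EFin \o V) z + (jrate K z)%:E <= (jrate K z * V z + C)%:E) ->
  (0 <= t)%R -> trans K t (fun=> 1) y = 1.
Proof.
move=> mV V0 C0 LV t0.
(* The absolute value serves [mpos2], which demands nonnegativity at negative times too; it
   disappears for s >= 0. *)
pose U (s : R) (z : T) := (V z + C * `|s|)%:E.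
have mU : mpos2 U.
  split; last by move=> s z; rewrite lee_fin addr_ge0// mulr_ge0.
  apply/measurable_EFinP; apply: measurable_funD; first exact: measurableT_comp.
  apply: measurable_funM => //.
  by apply: measurableT_comp.
have m1 : mpos2 (fun (_ : R) (_ : T) => 1) by apply: mpos2_cst; exact: mpos_cst.
have mV' : mpos (EFin \o V) by exact: mpos_EFin.
have stepU s z : (0 <= s)%R -> step K U s z + step K (fun _ _ => 1) s z <= U s z.
  move=> s0; rewrite -stepD//.
  set U1 := fun s z => U s z + 1.
  have mU1 : mpos2 U1.
    case: mU m1 => mU U0 [m1 _]; split; first exact: emeasurable_funD.
    by move=> a w; rewrite adde_ge0.
  apply: (@le_trans _ _ (V z + C * s)%:E); last by rewrite /U ger0_norm.
  have FTC := @step_FTC U1 z (fun s => V z + C * s)%R (fun=> C) s s0 mU1.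
  apply: le_trans (FTC _ _ _).
  - by rewrite leeDr// lee_fin mulr0 addr0 mulr_ge0// -lee_fin dec_ge0.
  - by move=> a _; apply: is_derive_eq; rewrite /GRing.scale/= add0r; ring.
  - by move=> a _; exact: cvg_cst.
  - move=> a a0.
    have -> : U1 a =
        (fun w => (EFin \o V) w + (C * a + 1)%:E).
      by apply/funext => w; rewrite /U1 /U ger0_norm//= -!EFinD addrA.
    have Ca : (0 <= C * a + 1)%R by rewrite addr_ge0// mulr_ge0.
    rewrite jintD//.
    rewrite jint_cst// mulrDl mul1r EFinD addeA addeAC.
    apply: le_trans (leeD (LV z) (lexx _)) _.
    by rewrite -EFinD lee_fin le_eqVlt; apply/predU1P; left; ring.
have key k s z : (0 <= s)%R ->
    k%:R%:E <= k%:R%:E * picard K k (fun=> 1) s z + U s z.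
  elim: k s z => [|k IH] s z s0; first by rewrite mul0e add0e; case: mU.
  have mk : mpos2 (picard K k (fun=> 1)) by apply: picard_mpos2; exact: mpos_cst.
  have mkk : mpos2 (fun s z => k%:R%:E * picard K k (fun=> 1) s z).
    case: mk => mk k0; split; first exact: emeasurable_funM.
    by move=> a w; rewrite mule_ge0.
  have k0 : 0 <= step K (picard K k (fun=> 1)) s z by case: (step_mpos2 K mk).
  rewrite [picard K k.+1 _ _ _]/= mule1 ge0_muleDr//; last exact: dec_ge0.
  (* Since dec + step 1 = 1, the number k + 1 splits into a no-jump part, k copies of step 1 to
     which the induction hypothesis applies under the integral, and one further copy, which counts
     the first jump and is absorbed by [stepU]. *)
  have e1 : k.+1%:R%:E = k.+1%:R%:E * (dec K z s)%:E +
      (step K (fun _ _ => k%:R%:E) s z + step K (fun _ _ => 1) s z).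
    have -> : step K (fun _ _ => k%:R%:E) s z = k%:R%:E * step K (fun _ _ => 1) s z.
      rewrite -stepZ//; congr (step K _ s z).
      by apply/funext => a; apply/funext => w; rewrite mule1.
    have := step_cst1 z s0; case: (step K _ s z) => // a.
    rewrite -!EFinM -!EFinD => -[da]; congr EFin.
    have -> : dec K z s = (1 - a)%R by lra.
    by rewrite -natr1; ring.
  rewrite [leLHS]e1.
  rewrite -[leRHS]addeA; apply: leeD => //.
  pose v s z := k%:R%:E * picard K k (fun=> 1) s z + U s z.
  apply: (@le_trans _ _ (step K v s z + step K (fun _ _ => 1) s z)).
    apply: leeD => //; apply: le_step.
    - by apply: mpos2_cst; exact: mpos_cst.
    - case: mkk mU => mk1 mk2 [mU1 mU2]; split; first exact: emeasurable_funD.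
      by move=> a w; rewrite adde_ge0.
    - by move=> a w /andP[a0 _]; exact: IH.
  rewrite stepD// -addeA; apply: leeD; last exact: stepU.
  rewrite stepZ//; apply: lee_wpmul2r => //.
  by rewrite lee_fin ler_nat.
apply/eqP; rewrite eq_le trans1_le1//= leNgt; apply/negP => p1.
set p := trans K t (fun=> 1) y in p1.
have p0 : 0 <= p.
  by case: (trans_mpos K t (mpos_cst (@ler01 R))) => _ /(_ y).
have pfin : p \is a fin_num.
  by rewrite ge0_fin_numE// (lt_trans p1)// ltry.
have {}key k : (k%:R * (1 - fine (p)) <= V y + C * `|t|)%R.
  rewrite mulrBr mulr1 lerBlDl -lee_fin EFinD EFinM fineK//.
  apply: le_trans (key k t y t0) _; apply: leeD => //; apply: lee_wpmul2l => //.
  exact: picard_le_trans.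
have q0 : (0 < 1 - fine (p))%R.
  by rewrite subr_gt0 -lte_fin fineK.
have := key (Num.bound ((V y + C * `|t|) / (1 - fine (p)))%R).
apply/negP; rewrite -ltNge -ltr_pdivrMr//.
apply: archi_boundP; apply: divr_ge0; last exact: ltW.
by rewrite addr_ge0// mulr_ge0.
Qed.

(** Keep only the paths with exactly one jump. Waiting before and after it costs a factor of at
    least exp(- M tau) each, and integrating over the jump time gives tau. The cutoff g' discards
    landing points of rate above M, where the second factor is not controlled. *)
Lemma trans_ge_local (M tau : R) g g' y : (0 < tau)%R -> mpos g -> mpos g' ->
  (jrate K y <= M)%R -> (forall z, g' z <= g z) ->
  (forall z, (M < jrate K z)%R -> g' z = 0) ->
  (tau * expR (- (M * tau)) ^+ 2)%:E * jint K g' y <= trans K tau g y.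
Proof.
move=> tau0 mg mg' yM gg' g'0.
apply: le_trans (picard_le_trans K 1 g tau y).
have [_ g0] := mg.
rewrite /picard -[X in X <= _]add0e.
apply: leeD; first by rewrite mule_ge0// dec_ge0.
set e := expR _.
have e0 : (0 <= e)%R by exact: expR_ge0.
have M0 : (0 <= M)%R by exact: le_trans (jrate_ge0 K y) yM.
have dec_ge z s : (jrate K z <= M)%R -> (0 <= s <= tau)%R -> (e <= dec K z s)%R.
  move=> zM /andP[s0 st]; rewrite ler_expR lerN2.
  by apply: ler_pM => //; exact: jrate_ge0.
have meg : mpos2 (fun (_ : R) z => e%:E * g' z) by apply: mpos2_cst; exact: mposZ.
have mp0 : mpos2 (fun s z => (dec K z s)%:E * g z + 0).
  exact: (picard_mpos2 K 0 mg).
apply: (@le_trans _ _ (step K (fun (_ : R) z => e%:E * g' z) tau y)); last first.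
  apply: le_step => // s z s01; rewrite adde0.
  have [zM|Mz] := leP (jrate K z) M; last by rewrite g'0// mule0 mule_ge0// dec_ge0.
  case: mg' => _ g'_ge0.
  by apply: lee_pmul => //; rewrite lee_fin// dec_ge.
apply: (@le_trans _ _ (\int[mu]_(s in `[0%R, tau]) (e%:E * (e%:E * jint K g' y)))).
  rewrite integral_cst//= lebesgue_measure_itv/= lte_fin tau0 oppr0 adde0.
  by rewrite expr2 !EFinM [leRHS]muleC -!muleA.
have [_ j0] := jint_mpos K mg'.
apply: ge0_le_integral => //.
- by move=> s _; rewrite !mule_ge0.
- by apply: measurable_funTS; exact: (step_mfun K y tau meg).
- move=> s /=; rewrite in_itv/= => s01; rewrite jintZ//.
  apply: lee_wpmul2r; first by rewrite mule_ge0.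
  by rewrite lee_fin dec_ge.
Qed.

Hypothesis trans1 : forall (t : R) y, (0 <= t)%R -> trans K t (fun=> 1) y = 1.

Lemma trans_le1 (t : R) g y : (0 <= t)%R -> mpos g -> (forall z, g z <= 1) ->
  trans K t g y <= 1.
Proof.
move=> t0 mg g1; rewrite -(trans1 y t0); apply: le_transP => //.
Qed.

Lemma trans_fin_num (t : R) g y : (0 <= t)%R -> mpos g -> (forall z, g z <= 1) ->
  trans K t g y \is a fin_num.
Proof.
move=> t0 mg g1; rewrite ge0_fin_numE; last by case: (trans_mpos K t mg).
by apply: le_lt_trans (trans_le1 y t0 mg g1) _; rewrite ltry.
Qed.

Lemma trans_cst (c t : R) y : (0 <= c)%R -> (0 <= t)%R ->
  trans K t (fun=> c%:E) y = c%:E.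
Proof.
move=> c0 t0.
have -> : (fun=> c%:E) = (fun _ : T => c%:E * 1) by apply/funext => z; rewrite mule1.
by rewrite transZ// ?trans1 ?mule1//; exact: mpos_cst.
Qed.

Lemma trans_compl (t : R) (f : T -> R) y : (0 <= t)%R -> measurable_fun setT f ->
  (forall z, 0 <= f z <= 1)%R ->
  trans K t (EFin \o f) y + trans K t (fun z => (1 - f z)%:E) y = 1.
Proof.
move=> t0 mf f01; rewrite -(trans1 y t0) -transD.
- by congr (trans K t _ y); apply/funext => z; rewrite /= -EFinD addrC subrK.
- by apply: mpos_EFin => // z; case/andP: (f01 z).
- apply: (mpos_EFin (f := fun z => 1 - f z)%R); first exact: measurable_funB.
  by move=> z; rewrite subr_ge0; case/andP: (f01 z).
Qed.

Lemma trans_add (s t : R) g y : (0 <= s)%R -> (0 <= t)%R -> mpos g ->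
  (forall z, g z <= 1) -> trans K (t + s) g y = trans K t (trans K s g) y.
Proof.
move=> s0 t0 mg g1.
apply/eqP; rewrite eq_le trans_add_le//=.
have [mg_ g0] := mg.
have gfin z : g z \is a fin_num.
  by rewrite ge0_fin_numE// (le_lt_trans (g1 z))// ltry.
pose f z := fine (g z).
have gf : g = EFin \o f by apply/funext => z; rewrite /= fineK.
have mf : measurable_fun setT f by exact: measurableT_comp.
have f01 z : (0 <= f z <= 1)%R by rewrite -!lee_fin fineK ?g0/=.
have mh : mpos (fun z => (1 - f z)%:E).
  apply: (mpos_EFin (f := fun z => 1 - f z)%R); first exact: measurable_funB.
  by move=> z; rewrite subr_ge0; case/andP: (f01 z).
have h1 z : (1 - f z)%:E <= 1 by rewrite lee_fin gerBl; case/andP: (f01 z).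
have ts0 : (0 <= t + s)%R by rewrite addr_ge0.
have e1 := trans_compl y ts0 mf f01; rewrite -gf in e1.
have e2 : trans K t (trans K s g) y + trans K t (trans K s (fun z => (1 - f z)%:E)) y = 1.
  rewrite -transD; [|exact: trans_mpos|exact: trans_mpos].
  rewrite -[RHS](trans1 y t0); congr (trans K t _ y); apply/funext => z.
  by have := trans_compl z s0 mf f01; rewrite -gf.
have le2 := trans_add_le K y s0 t0 mh.
have f1 := trans_fin_num y ts0 mg g1.
have f2 := trans_fin_num y ts0 mh h1.
have m3 := trans_mpos K s mg.
have f3 := trans_fin_num y t0 m3 (fun z => trans_le1 z s0 mg g1).
have m4 := trans_mpos K s mh.
have f4 := trans_fin_num y t0 m4 (fun z => trans_le1 z s0 mh h1).
move: f1 f2 f3 f4 e1 e2 le2.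
case: (trans _ (t + s) g y) => // a _; case: (trans _ (t + s) _ y) => // b _.
case: (trans _ t _ y) => // c _; case: (trans _ t _ y) => // e _.
rewrite -!EFinD !lee_fin => -[ab] [ce] be; lra.
Qed.

End conservative.

(** * Doeblin condition and stationary law *)

Local Opaque step jint dec trans.

Lemma le_geometric_slack (R : realType) (e c x z : R) : 0 < e -> e <= 1 -> 0 <= c ->
  (forall k, x <= z + c * (1 - e) ^+ k) -> x <= z.
Proof.
move=> e0 e1 c0 h.
have cv : (z + c * (1 - e) ^+ k) @[k --> \oo] --> z.
  rewrite -[X in _ --> X]addr0 -(mulr0 c).
  apply: cvgD; first exact: cvg_cst.
  apply: cvgM; first exact: cvg_cst.
  by apply: cvg_expr; rewrite ger0_norm ?subr_ge0// gtrBl.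
rewrite -(cvg_lim _ cv)//; apply: limr_ge; first by apply/cvg_ex; exists z.
by near=> k; exact: h.
Unshelve. all: by end_near. Qed.

(** The sum is the minimum of floor x + 1 and n. The induction carries the cap n in the upper bound
    as well: when n <= x, the new term fits below x + 1 because the previous sum is at most n. *)
Lemma sum_nat_le_bounds (R : realType) (n : nat) (x : R) : 0 <= x ->
  Num.min x n%:R <= \sum_(0 <= i < n) ((i%:R <= x)%R%:R : R) <= x + 1.
Proof.
move=> x0.
suff : Num.min x n%:R <= \sum_(0 <= i < n) ((i%:R <= x)%R%:R : R) <=
    Num.min (x + 1) n%:R.
  by case/andP => -> /= /le_trans; apply; rewrite ge_min lexx.
elim: n => [|n /andP[l u]].
  by rewrite big_geq// ge_min lexx orbT/= le_min lexx addr_ge0.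
rewrite big_nat_recr//= -natr1; move: l u; set S := \sum_(_ <= _ < _) _ => l u.
have /andP[u1 u2] : (S <= x + 1) && (S <= n%:R) by rewrite -le_min.
have [nx|xn] := leP n%:R x => /=; apply/andP; split.
- by rewrite ge_min lerD2r -(min_r nx) l orbT.
- by rewrite le_min !lerD2r u2 (le_trans u2 nx).
- by rewrite addr0 ge_min -(min_l (ltW xn)) l.
- by rewrite addr0 le_min u1 (le_trans u2)// lerDl.
Qed.

Section ergodic.
Context {R : realType} {d} {T : measurableType d}.
Variable K : jumpKernel R T.
Variables (T0 eps : R).
Hypothesis T0_ge0 : 0 <= T0.
Hypothesis eps_gt0 : 0 < eps.
Hypothesis eps_le1 : eps <= 1.
Hypothesis trans1 :
  forall (t : R) y, 0 <= t -> trans K t (fun=> 1%E) y = 1%E.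
Hypothesis doeblin : forall f : T -> R, measurable_fun setT f ->
  (forall z, 0 <= f z <= 1) ->
  (forall y, (eps%:E <= trans K T0 (EFin \o f) y)%E) \/
  (forall y, (eps%:E <= trans K T0 (fun z => (1 - f z)%:E) y)%E).
Local Open Scope ereal_scope.

Lemma indic_mpos (A : set T) : measurable A -> mpos (EFin \o \1_A : T -> \bar R).
Proof. by move=> mA; apply: mpos_EFin. Qed.

Lemma indic_le1 (A : set T) z : (EFin \o \1_A : T -> \bar R) z <= 1.
Proof. by rewrite /= lee_fin indicE; case: (_ \in _). Qed.

(** Rescale f to [0, 1]. A lower bound eps for the rescaled function lifts the lower end of the
    range by eps c; one for its complement lowers the upper end by as much. *)
Lemma osc_contract (f : T -> R) (a c : R) : measurable_fun setT f ->
  (0 <= a)%R -> (0 <= c)%R -> (forall z, a <= f z <= a + c)%R ->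
  exists2 a' : R, (0 <= a')%R &
    forall y, a'%:E <= trans K T0 (EFin \o f) y <= (a' + (1 - eps) * c)%:E.
Proof.
move=> mf a0 c0 fac.
have [c_eq0|c_neq0] := eqVneq c 0%R.
  exists a => // y.
  have -> : EFin \o f = fun=> a%:E.
    apply/funext => z /=; congr EFin; apply/eqP; rewrite eq_le.
    by case/andP: (fac z) => -> ; rewrite c_eq0 addr0 andbC => ->.
  by rewrite trans_cst// c_eq0 mulr0 addr0 lexx.
have c_gt0 : (0 < c)%R by rewrite lt_neqAle eq_sym c_neq0.
pose f' z := ((f z - a) / c)%R.
have mf' : measurable_fun setT f'.
  by apply: measurable_funM => //; exact: measurable_funB.
have f'01 z : (0 <= f' z <= 1)%R.
  case/andP: (fac z) => fa fc; rewrite /f' divr_ge0 ?subr_ge0//=.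
  by rewrite ler_pdivrMr// mul1r lerBlDl.
have mp' : mpos (EFin \o f') by apply: mpos_EFin => // z; case/andP: (f'01 z).
have f'1 z : (EFin \o f') z <= 1 by rewrite lee_fin; case/andP: (f'01 z).
have tf y : trans K T0 (EFin \o f) y = a%:E + c%:E * trans K T0 (EFin \o f') y.
  rewrite -transZ// -(trans_cst trans1 y a0 T0_ge0) -transD.
  - congr (trans K T0 _ y); apply/funext => z /=.
    by rewrite -EFinM -EFinD /f'; congr EFin; field.
  - exact: mpos_cst.
  - exact: mposZ.
have t0 y : 0 <= trans K T0 (EFin \o f') y by case: (trans_mpos K T0 mp').
have t1 y := trans_le1 trans1 y T0_ge0 mp' f'1.
have [h|h] := doeblin mf' f'01.
- exists (a + eps * c)%R; first by rewrite addr_ge0// mulr_ge0// ltW.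
  move=> y; rewrite tf; have := h y; have := t1 y; case: (trans _ _ _ y) => // b.
  rewrite -EFinM -EFinD !lee_fin => b1 bh; apply/andP; split; nra.
- exists a => // y; rewrite tf; have := h y; have := t0 y.
  have := trans_compl trans1 y T0_ge0 mf' f'01.
  have fin := trans_fin_num trans1 y T0_ge0 mp' f'1; rewrite -(fineK fin).
  set b := fine _; case: (trans K T0 _ y) => // b'.
  rewrite -EFinM -!EFinD !lee_fin => -[bb'] b0 hb; apply/andP; split; nra.
Qed.

(** The contraction is iterated k times; the interval then persists at all later times because the
    operator for the time t - k T0 averages and fixes constants. As the interval is common to all
    starting points, this gives both the limit and uniqueness. *)
Lemma confined (A : set T) k : measurable A ->
  exists a : R, forall t y, (k%:R * T0 <= t)%R ->
    a%:E <= trans K t (EFin \o \1_A) y <= (a + (1 - eps) ^+ k)%:E.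
Proof.
move=> mA; have mp := indic_mpos mA; have le1 := @indic_le1 A.
have k0 j : (0 <= j%:R * T0)%R by rewrite mulr_ge0.
suff [a a0 ha] : exists2 a : R, (0 <= a)%R & forall y,
    a%:E <= trans K (k%:R * T0) (EFin \o \1_A) y <= (a + (1 - eps) ^+ k)%:E.
  exists a => t y kt.
  have tk0 : (0 <= t - k%:R * T0)%R by rewrite subr_ge0.
  have r0 : (0 <= a + (1 - eps) ^+ k)%R.
    by rewrite addr_ge0// exprn_ge0// subr_ge0.
  rewrite -(subrK (k%:R * T0)%R t) trans_add//.
  have mk := trans_mpos K (k%:R * T0) mp.
  rewrite -[X in X <= _ <= _](trans_cst trans1 y a0 tk0).
  rewrite -[X in _ <= _ <= X](trans_cst trans1 y r0 tk0).
  by apply/andP; split; apply: le_transP => //;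
    rewrite ?(mpos_cst)// => z; case/andP: (ha z).
elim: k => [|k [a a0 IH]].
  exists 0%R => // y; rewrite mul0r expr0 add0r; apply/andP; split.
    by case: (trans_mpos K 0 mp).
  exact: trans_le1.
have mk := trans_mpos K (k%:R * T0) mp.
pose f z := fine (trans K (k%:R * T0) (EFin \o \1_A) z).
have fE : EFin \o f = trans K (k%:R * T0) (EFin \o \1_A).
  by apply/funext => z /=; rewrite fineK// trans_fin_num.
have mf : measurable_fun setT f by apply: measurableT_comp => //; case: mk.
have [|z|a' a'0 ha'] := @osc_contract f a ((1 - eps) ^+ k) mf a0.
- by rewrite exprn_ge0// subr_ge0.
- by rewrite -!lee_fin -[(f z)%:E]/((EFin \o f) z) fE.
- exists a' => // y; rewrite -natr1 mulrDl mul1r addrC trans_add//.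
  by rewrite exprS -fE.
Qed.

(** Eventual lower bounds, uniform in the starting point. Their supremum is the limit of P_t 1_A,
    defined before convergence is known. *)
Definition limset (A : set T) : set R :=
  [set a | exists t0, forall t y, (t0 <= t)%R -> a%:E <= trans K t (EFin \o \1_A) y].

Definition limprob (A : set T) : R := sup (limset A).

Lemma limprob_near (A : set T) k t y : measurable A -> (k%:R * T0 <= t)%R ->
  trans K t (EFin \o \1_A) y <= (limprob A + (1 - eps) ^+ k)%:E /\
  (limprob A)%:E <= trans K t (EFin \o \1_A) y + ((1 - eps) ^+ k)%:E.
Proof.
move=> mA kt; have [a ha] := confined k mA.
have aS : limset A a by exists (k%:R * T0)%R => s z ks; case/andP: (ha s z ks).
have ubS : ubound (limset A) (a + (1 - eps) ^+ k)%R.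
  move=> b [t0 hb]; rewrite -lee_fin.
  have m1 : (t0 <= Num.max t0 (k%:R * T0))%R by rewrite le_max lexx.
  have m2 : (k%:R * T0 <= Num.max t0 (k%:R * T0))%R by rewrite le_max lexx orbT.
  by apply: le_trans (hb _ y m1) _; case/andP: (ha _ y m2).
have l1 : (a <= limprob A)%R.
  by apply: ub_le_sup => //; exists (a + (1 - eps) ^+ k)%R.
have l2 : (limprob A <= a + (1 - eps) ^+ k)%R.
  by apply: ge_sup => //; exists a.
case/andP: (ha t y kt) => h1 h2; split.
  by apply: le_trans h2 _; rewrite lee_fin lerD2r.
apply: (@le_trans _ _ (a%:E + ((1 - eps) ^+ k)%:E)); first by rewrite -EFinD lee_fin.
exact: leeD.
Qed.

(** * The limit as a probability measure *)

Variable y0 : T.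

(** The law at time k T0 from a fixed y0. It is additive and within (1 - eps)^k of [limprob], which
    inherits its properties as k grows. *)
Definition mass (k : nat) (A : set T) : R :=
  fine (trans K (k%:R * T0) (EFin \o \1_A) y0).

Let time_ge0 (k : nat) : (0 <= k%:R * T0)%R.
Proof. by rewrite mulr_ge0. Qed.

Let slack_ge0 k : (0 <= (1 - eps) ^+ k)%R.
Proof. by rewrite exprn_ge0// subr_ge0. Qed.

Lemma massE k (A : set T) : measurable A ->
  (mass k A)%:E = trans K (k%:R * T0) (EFin \o \1_A) y0.
Proof.
move=> mA; rewrite fineK// trans_fin_num//; first exact: indic_mpos.
exact: indic_le1.
Qed.

Lemma mass_near k (A : set T) : measurable A ->
  (mass k A <= limprob A + (1 - eps) ^+ k /\
   limprob A <= mass k A + (1 - eps) ^+ k)%R.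
Proof.
move=> mA; have [] := @limprob_near A k (k%:R * T0)%R y0 mA (lexx _).
by rewrite -massE// -EFinD !lee_fin => h1 h2; split.
Qed.

Lemma mass_ge0 k (A : set T) : (0 <= mass k A)%R.
Proof.
rewrite fine_ge0//; apply: le_trans (picard_le_trans K 0 _ _ y0).
by rewrite /= adde0 mule_ge0 ?dec_ge0// lee_fin.
Qed.

Lemma le_mass k (A B : set T) : measurable A -> measurable B -> A `<=` B ->
  (mass k A <= mass k B)%R.
Proof.
move=> mA mB AB; rewrite -lee_fin !massE//.
apply: le_transP; [exact: indic_mpos|exact: indic_mpos|move=> z].
rewrite lee_fin !indicE ler_nat; case: (boolP (z \in A)) => // /set_mem zA.
by rewrite mem_set//; exact: AB.
Qed.

Lemma massU k (A B : set T) : measurable A -> measurable B -> [disjoint A & B] ->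
  mass k (A `|` B) = (mass k A + mass k B)%R.
Proof.
move=> mA mB AB; apply: EFin_inj; rewrite EFinD !massE//; last exact: measurableU.
rewrite -transD; [|exact: indic_mpos|exact: indic_mpos].
congr (trans K _ _ y0); apply/funext => z /=; rewrite -EFinD; congr EFin.
have /disj_setPS AB0 := AB.
rewrite !indicE in_setU -natrD; congr (_%:R).
case: (boolP (z \in A)) => zA; case: (boolP (z \in B)) => zB //.
by have := AB0 z (conj (set_mem zA) (set_mem zB)).
Qed.

Lemma mass_set0 k : mass k set0 = 0%R.
Proof.
rewrite /mass (_ : EFin \o \1_set0 = fun=> 0%:E) ?trans_cst//.
by apply/funext => z /=; rewrite indic0.
Qed.

Lemma mass_setT k : mass k setT = 1%R.
Proof.
rewrite /mass (_ : EFin \o \1_setT = fun=> 1%:E) ?trans1//.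
by apply/funext => z /=; rewrite indicT.
Qed.

Lemma limprob_slack (A : set T) (x c : R) : (0 <= c)%R ->
  (forall k, x <= limprob A + c * (1 - eps) ^+ k)%R -> (x <= limprob A)%R.
Proof. exact: le_geometric_slack. Qed.

Lemma limprob_ge0 (A : set T) : measurable A -> (0 <= limprob A)%R.
Proof.
move=> mA; apply: (@limprob_slack _ _ 1%R) => // k; rewrite mul1r.
by have [h _] := mass_near k mA; exact: le_trans (mass_ge0 k A) h.
Qed.

Lemma limprobU (A B : set T) : measurable A -> measurable B -> [disjoint A & B] ->
  limprob (A `|` B) = (limprob A + limprob B)%R.
Proof.
move=> mA mB AB; have mAB := measurableU _ _ mA mB.
apply/eqP; rewrite eq_le; apply/andP; split;
    (* One slack for each of A, B and their union. *)
    apply: (le_geometric_slack (c := 3%R) eps_gt0) => // k;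
    have eU := massU k mA mB AB; have [a1 a2] := mass_near k mA;
    have [b1 b2] := mass_near k mB; have [u1 u2] := mass_near k mAB;
    move: eU a1 a2 b1 b2 u1 u2; set r := ((1 - eps) ^+ k)%R; lra.
Qed.

Lemma le_limprob (A B : set T) : measurable A -> measurable B -> A `<=` B ->
  (limprob A <= limprob B)%R.
Proof.
move=> mA mB AB; apply: (@limprob_slack _ _ 2%R) => // k.
have eU := le_mass k mA mB AB.
have [a1 a2] := mass_near k mA; have [b1 b2] := mass_near k mB.
move: eU a1 a2 b1 b2; set r := ((1 - eps) ^+ k)%R; lra.
Qed.

Lemma limprob_set0 : limprob set0 = 0%R.
Proof.
apply/eqP; rewrite eq_le limprob_ge0// andbT.
apply: (le_geometric_slack (c := 1%R) eps_gt0) => // k.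
have [_ h] := mass_near k (@measurable0 _ T).
by rewrite mass_set0 in h; rewrite mul1r.
Qed.

Lemma limprob_setT : limprob setT = 1%R.
Proof.
apply/eqP; rewrite eq_le; apply/andP; split;
  apply: (le_geometric_slack (c := 1%R) eps_gt0) => // k;
  have [h1 h2] := mass_near k (@measurableT _ T);
  by rewrite mass_setT in h1 h2; rewrite mul1r.
Qed.

Lemma limprob_bigsetU (F : nat -> set T) n : (forall i, measurable (F i)) ->
  trivIset setT F ->
  limprob (\big[setU/set0]_(i < n) F i) = (\sum_(0 <= i < n) limprob (F i))%R.
Proof.
move=> mF tF; elim: n => [|n IH].
  by rewrite big_ord0 big_geq// limprob_set0.
rewrite big_ord_recr big_nat_recr//= -IH limprobU//.
  exact: bigsetU_measurable.
apply/disj_set2P; rewrite -subset0 => z [].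
rewrite -(bigcup_mkord n F) => -[i /= ilt Fi] Fn.
move/trivIsetP : tF => /(_ i n Logic.I Logic.I).
by rewrite (ltn_eqF ilt) => /(_ isT)/seteqP[+ _] => /(_ z); apply.
Qed.

(** A measure must be nonnegative on every set, while [limprob] is controlled on measurable sets
    only; hence the value 0 elsewhere. *)
Definition limmeasure (A : set T) : \bar R := if A \in measurable then (limprob A)%:E else 0.

Lemma limmeasureE A : measurable A -> limmeasure A = (limprob A)%:E.
Proof. by move=> mA; rewrite /limmeasure mem_set. Qed.

Lemma limmeasure_ge0 A : 0 <= limmeasure A.
Proof.
rewrite /limmeasure; case: ifPn => // /set_mem mA.
by rewrite lee_fin limprob_ge0.
Qed.

(** For fixed k the law at time k T0 is countably additive by monotone convergence, and replacing it
    by the limit costs the same slack for the union and for every partial union. So n may tend to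
    infinity before k does, with two slacks in all. *)
Lemma limmeasure_sigma_additive : semi_sigma_additive limmeasure.
Proof.
move=> F mF tF mUF.
pose G n := \big[setU/set0]_(i < n) F i.
have mG n : measurable (G n) by exact: bigsetU_measurable.
have GU n : G n `<=` \bigcup_i F i.
  by rewrite /G -(bigcup_mkord n F); exact: bigcup_sub_setT || (apply: bigcup_subset).
have -> : (fun n => \sum_(0 <= i < n) limmeasure (F i)) =
    EFin \o (fun n => limprob (G n)).
  apply/funext => n /=; rewrite limprob_bigsetU// -sumEFin.
  by apply: eq_bigr => i _; rewrite limmeasureE.
rewrite limmeasureE//; apply: cvg_EFin; first exact: nearW.
have ndG : {homo (fun n => limprob (G n)) : n m / (n <= m)%N >-> (n <= m)%R}.
  move=> n m nm; apply: le_limprob => //.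
  by rewrite /G; apply: subset_bigsetU.
have ubG : has_ubound (range (fun n => limprob (G n))).
  by exists (limprob (\bigcup_i F i)) => _ [n _ <-]; exact: le_limprob.
have -> : limprob (\bigcup_i F i) = sup (range (fun n => limprob (G n))).
  apply/eqP; rewrite eq_le; apply/andP; split; last first.
    apply: ge_sup; first by exists (limprob (G 0%N)); exists 0%N.
    by move=> _ [n _ <-]; exact: le_limprob.
  apply: (le_geometric_slack (c := 2%R) eps_gt0) => // k.
  have [_ h] := mass_near k mUF; apply: (le_trans h).
  rewrite mulr2n mulrDl mul1r addrA lerD2r -lee_fin massE//.
  have -> : EFin \o (\1_(\bigcup_i F i) : T -> R) =
      fun z => \sum_(0 <= i <oo) (EFin \o (\1_(F i) : T -> R)) z.
    apply/funext => z; apply/esym/cvg_lim => //.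
    exact: (@measure_semi_sigma_additive _ _ _ (dirac z) F).
  rewrite trans_nneseries; last by move=> i; exact: indic_mpos.
  apply: lime_le.
    apply: is_cvg_nneseries => i _ _.
    by case: (trans_mpos K (k%:R * T0) (indic_mpos (mF i))).
  near=> n.
  rewrite -trans_sum; last by move=> i; exact: indic_mpos.
  have -> : (fun z => \sum_(0 <= i < n) (EFin \o \1_(F i)) z) =
      EFin \o (\1_(G n) : T -> R).
    apply/funext => z; rewrite big_mkord; apply/esym.
    apply: (measure_semi_additive_ord_I (dirac z)) => //.
      exact: sub_trivIset tF.
    exact: mG.
  rewrite -(massE k (mG n)) lee_fin.
  have [h' _] := mass_near k (mG n); apply: (le_trans h').
  by rewrite lerD2r; apply: ub_le_sup => //; exists n.
exact: nondecreasing_cvgn.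
Unshelve. all: by end_near. Qed.

Lemma limmeasure_prob : exists pi : probability T R,
  forall A, measurable A -> pi A = (limprob A)%:E.
Proof.
have m0 : limmeasure set0 = 0 by rewrite limmeasureE// limprob_set0.
have m1 : limmeasure setT = 1 by rewrite limmeasureE// limprob_setT.
pose m : {measure set T -> \bar R} := HB.pack limmeasure
  (isMeasure.Build d T R limmeasure m0 limmeasure_ge0 limmeasure_sigma_additive).
pose p : probability T R := HB.pack (Measure.sort m)
  (Measure_isProbability.Build d T R m m1).
by exists p => A mA; exact: limmeasureE.
Qed.

(** * Invariance of the limit *)

Variable pi : probability T R.
Hypothesis piE : forall A, measurable A -> pi A = (limprob A)%:E.

Let int1 : \int[pi]_z (cst (1%R%:E : \bar R) z) = 1.
Proof.
by rewrite (integral_cst pi measurableT) mul1e; exact: (probability_setT pi).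
Qed.

(* pi is only known as a limit on sets, so h is sandwiched by the step function
   n^-1 * #{i < n | i <= n h}, which exceeds h by at most n^-1. *)
Lemma integral_limprob_le (h : T -> R) (t x : R) : measurable_fun setT h ->
  (forall z, 0 <= h z <= 1)%R -> (0 <= x)%R ->
  (forall k, trans K (k%:R * T0) (EFin \o h) y0 <= (x + (1 - eps) ^+ k)%:E) ->
  \int[pi]_z (h z)%:E <= x%:E.
Proof.
move=> mh h01 x0 hx.
have mph : mpos (EFin \o h) by apply: mpos_EFin => // z; case/andP: (h01 z).
have I0 : 0 <= \int[pi]_z (h z)%:E.
  by apply: integral_ge0 => z _; rewrite lee_fin; case/andP: (h01 z).
have I1 : \int[pi]_z (h z)%:E <= 1.
  rewrite -int1.
  apply: ge0_le_integral => //; [|exact/measurable_EFinP|].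
    by move=> z _; rewrite lee_fin; case/andP: (h01 z).
  by move=> z _; rewrite lee_fin; case/andP: (h01 z).
have Ifin : \int[pi]_z (h z)%:E \is a fin_num.
  by rewrite ge0_fin_numE// (le_lt_trans I1)// ltry.
rewrite -(fineK Ifin) lee_fin; apply/ler_addgt0Pr => e e0.
have [n ne] : exists n : nat, (n.+1%:R^-1 < e)%R.
  by have [n] := ltr_add_invr e0; rewrite add0r; exists n.
apply: le_trans (_ : x + n.+1%:R^-1 <= _)%R; last by rewrite lerD2l ltW.
(* With n fixed, one slack replaces [limprob] by the law at time k T0 on the n + 1 level sets, whose
   weights sum to 1; the other comes from [hx]. *)
apply: (le_geometric_slack (c := 2%R) eps_gt0) => // k.
rewrite -lee_fin fineK//.
pose w : R := (n.+1%:R^-1)%R.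
have w0 : (0 <= w)%R by rewrite invr_ge0.
pose E i := [set z | (i%:R <= n.+1%:R * h z)%R].
have mE i : measurable (E i).
  rewrite -[E i]setTI; apply: (measurable_fun_le (f := cst i%:R)) => //.
  exact: measurable_funM.
pose s z := \sum_(0 <= i < n.+1) w%:E * (EFin \o (\1_(E i) : T -> R)) z.
have sE z : s z = (w * \sum_(0 <= i < n.+1) ((i%:R <= n.+1%:R * h z)%R%:R : R))%:E.
  rewrite /s -ge0_sume_distrr; last by move=> i _; rewrite lee_fin.
  rewrite EFinM -sumEFin; congr (_ * _); apply: eq_bigr => i _ /=.
  by rewrite indicE mem_setE.
have bnd z := sum_nat_le_bounds n.+1 (x := n.+1%:R * h z).
have n0 : (0 < n.+1%:R :> R)%R by [].
have hs z : (h z)%:E <= s z.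
  have /andP[z0 z1] := h01 z.
  have /andP[+ _] := bnd z (mulr_ge0 (ler0n _ _) z0).
  rewrite min_l; last by rewrite ler_piMr.
  by rewrite sE lee_fin /w ler_pdivlMl.
have sh z : s z <= (h z + w)%:E.
  have /andP[z0 z1] := h01 z.
  have /andP[_] := bnd z (mulr_ge0 (ler0n _ _) z0).
  by rewrite sE lee_fin /w ler_pdivrMl// mulrDr mulfV ?gt_eqF.
have mw i : mpos (fun z => w%:E * (EFin \o (\1_(E i) : T -> R)) z).
  by apply: mposZ => //; exact: indic_mpos.
have ms : mpos s by apply: mpos_sum.
apply: (@le_trans _ _ (\int[pi]_z s z)).
  apply: ge0_le_integral; first exact: measurableT.
  - by move=> z _; rewrite lee_fin; case/andP: (h01 z).
  - exact/measurable_EFinP.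
  - by case: ms.
  - by move=> z _; exact: hs.
have -> : \int[pi]_z s z = \sum_(0 <= i < n.+1) w%:E * (limprob (E i))%:E.
  rewrite ge0_integral_sum//; [|by move=> i; case: (mw i)|by move=> i z _; case: (mw i)].
  apply: eq_bigr => i _; have [mi i0] := indic_mpos (mE i).
  rewrite ge0_integralZl// integral_indic// setIT.
  by congr (_ * _); exact: piE.
apply: (@le_trans _ _ (\sum_(0 <= i < n.+1) (w%:E *
    trans K (k%:R * T0) (EFin \o (\1_(E i) : T -> R)) y0 + (w * (1 - eps) ^+ k)%:E))).
  apply: lee_sum => i _; rewrite EFinM -ge0_muleDr//; last 2 first.
  - by case: (trans_mpos K (k%:R * T0) (indic_mpos (mE i))).
  - by rewrite lee_fin.
  apply: lee_wpmul2l; first by rewrite lee_fin.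
  by case: (limprob_near y0 (mE i) (lexx (k%:R * T0)%R)).
rewrite big_split/=.
have -> : \sum_(0 <= i < n.+1) w%:E *
    trans K (k%:R * T0) (EFin \o (\1_(E i) : T -> R)) y0 = trans K (k%:R * T0) s y0.
  rewrite trans_sum//; apply: eq_bigr => i _.
  by rewrite transZ//; exact: indic_mpos.
rewrite sumEFin sumr_const_nat subn0 -[((w * _) *+ _)%R]mulr_natl mulrA divff ?gt_eqF// mul1r.
have mhw : mpos (fun z => (h z)%:E + w%:E) by apply: mposD => //; exact: mpos_cst.
have le1 : trans K (k%:R * T0) s y0 <= trans K (k%:R * T0) (fun z => (h z)%:E + w%:E) y0.
  by apply: le_transP => // z; exact: sh.
apply: le_trans (leeD le1 (lexx _)) _.
rewrite transD; [|exact: mph|exact: mpos_cst].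
rewrite trans_cst//; apply: le_trans (leeD (leeD (hx k) (lexx _)) (lexx _)) _.
rewrite -!EFinD lee_fin /w.
set r := ((1 - eps) ^+ k)%R; set q := (n.+1%:R^-1)%R; lra.
Qed.

(** Only the inequality <= is proved directly, for every measurable set. Applied to A and to its
    complement, whose two sides both add up to 1, it forces equality. *)
Lemma limprob_stationary (t : R) (A : set T) : (0 <= t)%R -> measurable A ->
  \int[pi]_z trans K t (EFin \o (\1_A : T -> R)) z = pi A.
Proof.
move=> t0 mA.
suff le B : measurable B ->
    \int[pi]_z trans K t (EFin \o (\1_B : T -> R)) z <= (limprob B)%:E.
  have mAC : measurable (~` A) by exact: measurableC.
  have [mtA tA0] := trans_mpos K t (indic_mpos mA).
  have [mtC tC0] := trans_mpos K t (indic_mpos mAC).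
  have sum1 : \int[pi]_z trans K t (EFin \o (\1_A : T -> R)) z +
      \int[pi]_z trans K t (EFin \o (\1_(~` A) : T -> R)) z = 1.
    rewrite -ge0_integralD//.
    rewrite -[RHS]int1.
    apply: eq_integral => z _.
    have A01 w : (0 <= (\1_A w : R) <= 1)%R by rewrite indicE; case: (_ \in _) => /=; rewrite ?lexx ?ler01.
    rewrite -(trans_compl trans1 z t0 _ A01)//; congr (_ + trans K t _ z).
    apply/funext => w /=; rewrite !indicE in_setC.
    by case: (_ \in _); rewrite /= ?subrr ?subr0.
  have eC : (limprob (~` A) = 1 - limprob A)%R.
    rewrite -limprob_setT -(setUv A) limprobU// ?disj_set2E ?setICr//.
    by rewrite addrAC subrr add0r.
  rewrite piE//; move: sum1 (le A mA) (le _ mAC); rewrite eC.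
  have iA0 : 0 <= \int[pi]_z trans K t (EFin \o (\1_A : T -> R)) z.
    by apply: integral_ge0 => z _.
  have iC0 : 0 <= \int[pi]_z trans K t (EFin \o (\1_(~` A) : T -> R)) z.
    by apply: integral_ge0 => z _.
  move: iA0 iC0; case: (\int[pi]_z _) => // a; case: (\int[pi]_z _) => // b _ _.
  rewrite -EFinD !lee_fin => -[ab] h1 h2; congr EFin; lra.
move=> mB; have mp := indic_mpos mB.
have m1 := trans_mpos K t mp.
pose h z := fine (trans K t (EFin \o (\1_B : T -> R)) z).
have hE : EFin \o h = trans K t (EFin \o (\1_B : T -> R)).
  by apply/funext => z /=; rewrite fineK// trans_fin_num//; exact: indic_le1.
have hEz z : (h z)%:E = trans K t (EFin \o (\1_B : T -> R)) z by rewrite -hE.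
under eq_integral do rewrite -hEz.
apply: integral_limprob_le => //.
- by apply: measurableT_comp => //; case: m1.
- move=> z; rewrite -!lee_fin hEz; apply/andP; split; first by case: m1.
  by apply: trans_le1 => //; exact: indic_le1.
- exact: limprob_ge0.
(* Applying P_{k T0} to P_t 1_B gives P_{k T0 + t} 1_B, which is within the slack of the limit
   because k T0 + t >= k T0. *)
- move=> k; rewrite hE -trans_add//; last exact: indic_le1.
  by case: (@limprob_near B k (k%:R * T0 + t)%R y0 mB) => //; rewrite lerDl.
Qed.

End ergodic.

(** The second clause passes nullity from the laws started at y0 to the limit; it serves to show
    that pi does not charge the complement of the orthant. *)
Theorem ergodic (R : realType) d (T : measurableType d) (K : jumpKernel R T)
    (T0 eps : R) (y0 : T) : 0 <= T0 -> 0 < eps -> eps <= 1 ->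
  (forall (t : R) y, 0 <= t -> trans K t (fun=> 1%E) y = 1%E) ->
  (forall f : T -> R, measurable_fun setT f -> (forall z, 0 <= f z <= 1) ->
    (forall y, (eps%:E <= trans K T0 (EFin \o f) y)%E) \/
    (forall y, (eps%:E <= trans K T0 (fun z => (1 - f z)%:E) y)%E)) ->
  exists pi : probability T R,
    (forall (t : R) A, 0 <= t -> measurable A ->
      (\int[pi]_z trans K t (EFin \o (\1_A : T -> R)) z = pi A)%E) /\
    (forall A, measurable A ->
      (forall t : R, 0 <= t -> trans K t (EFin \o (\1_A : T -> R)) y0 = 0%E) ->
      pi A = 0%E).
Proof.
move=> T00 e0 e1 t1 db.
have [pi piE] := limmeasure_prob T00 e0 e1 t1 db y0.
exists pi; split=> [t A t0 mA|A mA A0].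
  exact: (limprob_stationary T00 e0 e1 t1 db y0 piE).
rewrite piE//; congr EFin; apply/eqP; rewrite eq_le.
rewrite (limprob_ge0 T00 e0 e1 t1 db y0 mA) andbT.
apply: (le_geometric_slack (c := 1) e0) => // k.
have [_] := limprob_near T00 e0 e1 t1 db y0 mA (lexx (k%:R * T0)).
by rewrite A0 ?mulr_ge0// add0e lee_fin add0r mul1r.
Qed.

(** * The jump kernel of the gap process *)

Local Opaque step jint dec trans.

Section gap_kernel.
Context {R : realType} (theta : probability R R) (m : nat).
Notation T := (state R m).
Notation unif := (uniform_prob (@ltr01 R)).
Local Open Scope ereal_scope.

(* The chain is extended from the orthant to all states by letting y jump as its
   positive part does, so that rates are nonnegative without side conditions. *)
Definition clip (y : T) : T := [tuple Num.max 0%R (tnth y j) | j < m].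

Definition coord (i : nat) (y : T) : R := nth 0%R (clip y) i.

(** At i = m - 1 the addition to coordinate i + 1 is void, so the same formula covers the last gap,
    whose mass leaves the system. *)
Definition slide (y : T) (i : nat) (u : R) : T := jump_mid (clip y) i u.

(** Truncating z makes every push land in the orthant; it changes nothing almost surely when theta
    is carried by the positive reals. *)
Definition push (y : T) (z : R) : T := jump_lead (clip y) (Num.max 0%R z).

Lemma coord_tnth (j : 'I_m) y : coord j y = Num.max 0%R (tnth y j).
Proof. by rewrite /coord -tnth_nth tnth_mktuple. Qed.

Lemma coord_out i y : (m <= i)%N -> coord i y = 0%R.
Proof. by move=> mi; rewrite /coord nth_default// size_tuple. Qed.

Lemma coord_ge0 i y : (0 <= coord i y)%R.
Proof.
have [im|mi] := ltnP i m; last by rewrite coord_out.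
by rewrite (coord_tnth (Ordinal im)) le_max lexx.
Qed.

Lemma tnth_clip y (j : 'I_m) : tnth (clip y) j = coord j y.
Proof. by rewrite /coord -tnth_nth. Qed.

Lemma clip_id y : orthant y -> clip y = y.
Proof.
by move=> Oy; apply: eq_from_tnth => j; rewrite tnth_mktuple max_r.
Qed.

Lemma tnth_slide y i u (j : 'I_m) : tnth (slide y i u) j =
  (coord j y + (if j == i :> nat then - (coord i y * u) else 0) +
   (if j == i.+1 :> nat then coord i y * u else 0))%R.
Proof.
rewrite tnth_mktuple -(tnth_nth _ _ j) tnth_mktuple.
by rewrite -[nth _ _ j]/(coord j y).
Qed.

Lemma tnth_push y z (j : 'I_m) : tnth (push y z) j =
  (coord j y + (if j == 0 :> nat then Num.max 0 z else 0))%R.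
Proof. by rewrite tnth_mktuple. Qed.

Lemma coord_mfun i : measurable_fun setT (coord i).
Proof.
have [im|mi] := ltnP i m; last first.
  rewrite (_ : coord i = cst 0%R)//; apply/funext => y; exact: coord_out.
rewrite (_ : coord i = fun y => Num.max 0%R (tnth y (Ordinal im))).
  by apply: measurable_maxr => //; exact: measurable_tnth.
by apply/funext => y; rewrite -coord_tnth.
Qed.

Lemma slide_mfun i : measurable_fun setT (fun p : T * R => slide p.1 i p.2).
Proof.
apply/measurable_fun_tnthP => j.
rewrite (_ : _ \o _ = fun p : T * R =>
  (coord j p.1 + (if j == i :> nat then - (coord i p.1 * p.2) else 0) +
   (if j == i.+1 :> nat then coord i p.1 * p.2 else 0))%R); last first.
  by apply/funext => p /=; rewrite tnth_slide.
have mc k : measurable_fun setT (fun p : T * R => coord k p.1).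
  exact: measurableT_comp (coord_mfun k) _.
have mcu : measurable_fun setT (fun p : T * R => coord i p.1 * p.2)%R.
  exact: measurable_funM.
apply: measurable_funD; last by case: (nat_of_ord j == i.+1).
apply: measurable_funD => //; case: (nat_of_ord j == i) => //.
exact: measurableT_comp.
Qed.

Lemma push_mfun : measurable_fun setT (fun p : T * R => push p.1 p.2).
Proof.
apply/measurable_fun_tnthP => j.
rewrite (_ : _ \o _ = fun p : T * R =>
  (coord j p.1 + (if j == 0 :> nat then Num.max 0 p.2 else 0))%R); last first.
  by apply/funext => p /=; rewrite tnth_push.
apply: measurable_funD; first exact: measurableT_comp (coord_mfun j) _.
by case: (nat_of_ord j == 0%N) => //; exact: measurable_maxr.
Qed.

Lemma slide_mfun1 y i :
  measurable_fun setT (fun u : measurableTypeR R => slide y i u).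
Proof.
apply: (measurableT_comp (slide_mfun i) (g := fun u : R => (y, u))).
exact: measurable_fun_pair.
Qed.

Lemma push_mfun1 y : measurable_fun setT (push y).
Proof.
apply: (measurableT_comp push_mfun (g := fun u : R => (y, u))).
exact: measurable_fun_pair.
Qed.

Definition slide_measure (y : T) (i : nat) : {measure set T -> \bar R} :=
  mscale (NngNum (coord_ge0 i y))
    (measure_function_pushforward__canonical__measure_function_Measure
      unif (slide_mfun1 y i)).

Definition push_measure (y : T) : {measure set T -> \bar R} :=
  measure_function_pushforward__canonical__measure_function_Measure
    theta (push_mfun1 y).

Definition gap_measure (y : T) : {measure set T -> \bar R} :=
  measure_add (msum (slide_measure y) m) (push_measure y).

Lemma integral_gap_measure (g : T -> \bar R) y : mpos g ->
  \int[gap_measure y]_z g z =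
  \sum_(i < m) ((coord i y)%:E * \int[unif]_u g (slide y i u)) +
  \int[theta]_z g (push y z).
Proof.
move=> [mg g0]; rewrite ge0_integral_measure_add// ge0_integral_measure_sum//.
congr (_ + _); last first.
  by rewrite ge0_integral_pushforward//; exact: push_mfun1.
apply: eq_bigr => i _; rewrite ge0_integral_mscale//; congr (_ * _).
by rewrite ge0_integral_pushforward//; exact: slide_mfun1.
Qed.

Definition total_rate (y : T) : R := (1 + \sum_(i < m) coord i y)%R.

Lemma gap_measureT y : gap_measure y setT = (total_rate y)%:E.
Proof.
rewrite -[LHS]mul1e -(integral_cst (gap_measure y) measurableT 1).
rewrite integral_gap_measure; last exact: (mpos_cst (@ler01 R)).
rewrite [X in _ + X](integral_cst theta measurableT 1) mul1e.
rewrite [X in _ + X](probability_setT theta).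
rewrite /total_rate EFinD addeC; congr (_ + _).
rewrite -sumEFin; apply: eq_bigr => i _.
rewrite [X in _ * X](integral_cst unif measurableT 1) mul1e.
by rewrite [X in _ * X](probability_setT unif) mule1.
Qed.

Lemma total_rate_ge0 y : (0 <= total_rate y)%R.
Proof. by rewrite addr_ge0// sumr_ge0// => i _; exact: coord_ge0. Qed.

Lemma total_rate_mfun : measurable_fun setT total_rate.
Proof.
apply: measurable_funD => //.
by apply: measurable_sum => i; exact: coord_mfun.
Qed.

Lemma gap_measure_mfun (u : R -> T -> \bar R) : mpos2 u ->
  measurable_fun setT (fun p : R * T => \int[gap_measure p.2]_z u p.1 z).
Proof.
move=> mu2; have [mu u0] := mu2.
have -> : (fun p : R * T => \int[gap_measure p.2]_z u p.1 z) = (fun p =>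
   \sum_(i < m) ((coord i p.2)%:E * \int[unif]_v u p.1 (slide p.2 i v)) +
  \int[theta]_z u p.1 (push p.2 z)).
  apply/funext => p; rewrite integral_gap_measure//; exact: mpos2_mpos.
apply: emeasurable_funD.
  apply: emeasurable_sum => i; apply: emeasurable_funM.
    apply: measurableT_comp => //; exact: measurableT_comp (coord_mfun i) _.
  apply: (measurable_fun_fubini_tonelli_F (m2 := unif)
    (fun q : (R * T) * R => u q.1.1 (slide q.1.2 i q.2))) => //.
  apply: (measurableT_comp mu
    (g := fun q : (R * T) * R => (q.1.1, slide q.1.2 i q.2))).
  apply: measurable_fun_pair; first exact: measurableT_comp.
  apply: (measurableT_comp (slide_mfun i)
    (g := fun q : (R * T) * R => (q.1.2, q.2))).
  by apply: measurable_fun_pair => //; exact: measurableT_comp.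
apply: (measurable_fun_fubini_tonelli_F (m2 := theta)
  (fun q : (R * T) * R => u q.1.1 (push q.1.2 q.2))) => //.
apply: (measurableT_comp mu
  (g := fun q : (R * T) * R => (q.1.1, push q.1.2 q.2))).
apply: measurable_fun_pair; first exact: measurableT_comp.
apply: (measurableT_comp push_mfun
  (g := fun q : (R * T) * R => (q.1.2, q.2))).
by apply: measurable_fun_pair => //; exact: measurableT_comp.
Qed.

Definition gap_kernel : jumpKernel R T := JumpKernel
  total_rate_ge0 total_rate_mfun gap_measureT gap_measure_mfun.

Lemma jint_gap (g : T -> \bar R) y : mpos g -> jint gap_kernel g y =
  \sum_(i < m) ((coord i y)%:E * \int[unif]_u g (slide y i u)) +
  \int[theta]_z g (push y z).
Proof. exact: integral_gap_measure. Qed.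

Lemma integral_unif (g : R -> \bar R) : measurable_fun setT g ->
  (forall u, 0 <= g u) ->
  \int[unif]_u g u = \int[@lebesgue_measure R]_(u in `[0%R, 1%R]) g u.
Proof. by move=> mg g0; rewrite integral_uniform// subr0 invr1 mul1e. Qed.

Lemma orthant_slide y i (u : R) : (0 <= u <= 1)%R -> orthant (slide y i u).
Proof.
move=> /andP[u0 u1] j; rewrite tnth_slide.
have cu i' : (0 <= coord i' y * u)%R by rewrite mulr_ge0// coord_ge0.
have cu1 : (0 <= coord i y - coord i y * u)%R.
  by rewrite subr_ge0 ler_piMr// coord_ge0.
have [->|ji] := eqVneq (nat_of_ord j) i.
  by rewrite (ltn_eqF (ltnSn i)) addr0.
by rewrite addr0; case: ifP => _; rewrite ?addr0 ?addr_ge0// coord_ge0.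
Qed.

Lemma orthant_push y z : orthant (push y z).
Proof.
move=> j; rewrite tnth_push; case: ifP => _; rewrite ?addr0 ?coord_ge0//.
by rewrite addr_ge0 ?coord_ge0// le_max lexx.
Qed.

Lemma jump_last_mid (y : T) u : (0 < m)%N -> jump_last y u = jump_mid y m.-1 u.
Proof.
move=> m0; apply: eq_from_tnth => j; rewrite !tnth_mktuple.
rewrite [X in _ = (X + _)%R](_ : _ = tnth (addat y m.-1 (- (nth 0 y m.-1 * u))) j)%R.
  by rewrite tnth_mktuple prednK// (ltn_eqF (ltn_ord j)) addr0.
exact/esym/tnth_nth.
Qed.

(** * Agreement with [Ptrans] on the orthant *)

Import HBNNSimple.

(** No measurability of f is needed because the integral is a supremum over simple functions below
    f, and multiplying such a function by the indicator of D does not change its own integral. *)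
Lemma nnintegral_restrict_full d (X : measurableType d) (P : probability X R)
    (D : set X) (f : X -> \bar R) : measurable D -> P D = 1 ->
  (forall x, 0 <= f x) -> \int[P]_x f x = \int[P]_x (f \_ D) x.
Proof.
move=> mD PD f0.
have fD0 x : 0 <= (f \_ D) x by rewrite erestrict_ge0.
rewrite !ge0_integralTE//; apply/eqP; rewrite eq_le; apply/andP; split; last first.
  apply: le_ereal_sup => _ [h /= hf <-]; exists h => // x.
  by apply: le_trans (hf x) _; rewrite /patch; case: ifP.
apply: ge_ereal_sup => _ [h /= hf <-].
apply: (@le_trans _ _ (sintegral P (proj_nnsfun h mD))); last first.
  apply: ereal_sup_ubound; exists (proj_nnsfun h mD) => // x.
  by rewrite -mrestrict /patch; case: ifPn.
rewrite -!integralT_nnsfun -mrestrict.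
have PDC : P (~` D) = 0 by rewrite probability_setC// PD subee.
rewrite (ge0_negligible_integral (N := ~` D))//; last 3 first.
- exact: measurableC.
- exact/measurable_EFinP.
- by move=> x _; rewrite lee_fin.
rewrite setTD setCK integral_mkcond.
by under eq_integral => x _ do rewrite restrict_EFin.
Qed.

(* Nothing is assumed about the measurability of f: Piter is only controlled on
   the orthant. *)
Lemma eq_integral_full d (X : measurableType d) (P : probability X R)
    (D : set X) (f g : X -> \bar R) : measurable D -> P D = 1 ->
  (forall x, D x -> f x = g x) -> \int[P]_x f x = \int[P]_x g x.
Proof.
move=> mD PD fg.
suff E h : \int[P]_x h x = \int[P]_(x in D) h x.
  by rewrite E [RHS]E; apply: eq_integral => x /set_mem; exact: fg.
rewrite [LHS]integralE [RHS]integralE.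
by congr (_ - _); rewrite [RHS]integral_mkcond; exact: nnintegral_restrict_full.
Qed.

Hypothesis m_gt0 : (0 < m)%N.
Hypothesis theta_gt0 : theta [set z : R | 0 < z]%R = 1.

Lemma jumpint_gap (f g : T -> \bar R) y : orthant y -> mpos g ->
  (forall z, orthant z -> f z = g z) ->
  jumpint theta f y = jint gap_kernel g y.
Proof.
move=> Oy mg fg; rewrite jint_gap// /jumpint.
have [mg_ g0] := mg.
have yc i : ycoord y i = coord i y by rewrite /coord clip_id.
have lead : \int[theta]_z f (jump_lead y z) = \int[theta]_z g (push y z).
  apply: (eq_integral_full (D := [set z : R | 0 < z]%R)) => //.
    by rewrite -set_itvoy; exact: measurable_itv.
  move=> z /= z0; rewrite /push clip_id// max_r ?ltW//; apply: fg.
  have := orthant_push y z; rewrite /push clip_id// max_r//; exact: ltW.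
have mid i : \int[@lebesgue_measure R]_(u in `[0%R, 1%R]) f (jump_mid y i u) =
    \int[unif]_u g (slide y i u).
  rewrite integral_unif//; last exact: measurableT_comp mg_ (slide_mfun1 y i).
  apply: eq_integral => u; rewrite inE/= in_itv/= => u01.
  by rewrite /slide clip_id// fg//; have := orthant_slide y i u01; rewrite /slide clip_id.
rewrite lead; congr (_ + _).
have -> : \int[@lebesgue_measure R]_(u in `[0%R, 1%R]) f (jump_last y u) =
    \int[unif]_u g (slide y m.-1 u).
  by rewrite -mid; apply: eq_integral => u _; rewrite jump_last_mid.
have -> : \sum_(i < m.-1) ((ycoord y i)%:E *
      \int[@lebesgue_measure R]_(u in `[0%R, 1%R]) f (jump_mid y i u)) =
    \sum_(i < m.-1) ((coord i y)%:E * \int[unif]_u g (slide y i u)).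
  by apply: eq_bigr => i _; rewrite yc mid.
by rewrite yc addeC -[in RHS](prednK m_gt0) big_ord_recr.
Qed.

Lemma rate_total (y : T) : orthant y -> rate y = total_rate y.
Proof.
move=> Oy; rewrite /rate /total_rate; congr (_ + _)%R.
by apply: eq_bigr => j _; rewrite -tnth_clip clip_id.
Qed.

Local Transparent dec step trans.

Lemma decay_dec (y : T) s : orthant y -> decay y s = dec gap_kernel y s.
Proof. by move=> Oy; rewrite /decay /dec rate_total. Qed.

Lemma step_Piter (f g : R -> T -> \bar R) (t : R) y : orthant y -> mpos2 g ->
  (forall s z, orthant z -> f s z = g s z) ->
  \int[@lebesgue_measure R]_(s in `[0%R, t])
    ((decay y s)%:E * jumpint theta (f (t - s)%R) y) = step gap_kernel g t y.
Proof.
move=> Oy mg fg; rewrite /step; apply: eq_integral => s _.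
rewrite decay_dec//; congr (_ * _); apply: jumpint_gap => //.
  exact: mpos2_mpos.
by move=> z; exact: fg.
Qed.

Local Opaque dec step.

Lemma Piter_picard k (t : R) y A : orthant y -> measurable A ->
  Piter theta k t y A = picard gap_kernel k (EFin \o (\1_A : T -> R)) t y.
Proof.
move=> + mA; elim: k t y => [|k IH] t y Oy.
  by rewrite /= adde0 decay_dec.
rewrite /= decay_dec//; congr (_ + _).
apply: (step_Piter (f := fun s z => Piter theta k s z A)) => //.
by apply: picard_mpos2; apply: mpos_EFin.
Qed.

Lemma Ptrans_trans (t : R) y A : orthant y -> measurable A ->
  Ptrans theta t y A = trans gap_kernel t (EFin \o (\1_A : T -> R)) y.
Proof.
move=> Oy mA; rewrite /Ptrans /trans; congr (ereal_sup _).
by apply: eq_imagel => k _; rewrite Piter_picard.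
Qed.

End gap_kernel.

(** * Lyapunov function *)

Local Opaque step jint dec trans.

Lemma measurable_inv_pos (R : realType) d (X : measurableType d) (f : X -> R) :
  measurable_fun setT f -> (forall x, 0 < f x) ->
  measurable_fun setT (fun x => (f x)^-1).
Proof.
move=> mf f0; rewrite (_ : (fun x => _) = (fun x => expR (- ln (f x)))).
  apply: (measurableT_comp (f := @expR R)) => //.
  apply: (measurableT_comp (f := -%R : R -> R)) => //.
  by apply: (measurableT_comp (f := @ln R)) => //; exact: measurable_ln.
by apply/funext => x; rewrite expRN lnK ?posrE.
Qed.

Section lyapunov.
Context {R : realType} (theta : probability R R) (m : nat).
Notation T := (state R m).
Notation unif := (uniform_prob (@ltr01 R)).
Notation K := (gap_kernel theta m).
Hypothesis theta_gt0 : theta [set z : R | 0 < z] = 1%E.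
Hypothesis theta_mean : (\int[theta]_z z%:E = 1)%E.

Definition lyap (y : T) : R := \sum_(i < m) (m - i)%:R * coord i y.

Definition sqsum (y : T) : R := \sum_(i < m) coord i y ^+ 2.

Lemma lyap_ge0 y : 0 <= lyap y.
Proof. by apply: sumr_ge0 => i _; rewrite mulr_ge0// coord_ge0. Qed.

Lemma lyap_mfun : measurable_fun setT lyap.
Proof.
by apply: measurable_sum => i; apply: measurable_funM => //; exact: coord_mfun.
Qed.

Lemma coord_orthant (y : T) (j : 'I_m) : orthant y -> coord j y = tnth y j.
Proof. by move=> Oy; rewrite coord_tnth max_r. Qed.

Lemma coord_slide (y : T) i (u : R) (j : 'I_m) : 0 <= u <= 1 ->
  coord j (slide y i u) =
  coord j y + (if j == i :> nat then - (coord i y * u) else 0) +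
  (if j == i.+1 :> nat then coord i y * u else 0).
Proof. by move=> u01; rewrite coord_orthant ?tnth_slide//; exact: orthant_slide. Qed.

Lemma coord_push (y : T) z (j : 'I_m) :
  coord j (push y z) = coord j y + (if j == 0 :> nat then Num.max 0 z else 0).
Proof. by rewrite coord_orthant ?tnth_push//; exact: orthant_push. Qed.

Lemma sum_pick (F : nat -> R) (c : R) i :
  \sum_(j < m) F j * (if j == i :> nat then c else 0) =
  if (i < m)%N then F i * c else 0.
Proof.
case: ifPn => [im|].
  rewrite (bigD1 (Ordinal im))//= eqxx big1 ?addr0// => j ji.
  by rewrite ifN ?mulr0//; move: ji; rewrite -val_eqE.
rewrite -leqNgt => mi; rewrite big1// => j _.
by rewrite ifN ?mulr0// ltn_eqF// (leq_trans (ltn_ord j)).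
Qed.

Lemma sum_pick1 (c : R) k : \sum_(j < m) (if j == k :> nat then c else 0) =
  if (k < m)%N then c else 0.
Proof.
by rewrite -[c in RHS]mul1r -(sum_pick (fun=> 1)); apply: eq_bigr => j _; rewrite mul1r.
Qed.

(** Consecutive weights differ by one. At the last gap the truncated [m - i.+1] is 0, the right
    weight for mass that leaves. *)
Lemma lyap_slide (y : T) (i : 'I_m) (u : R) : 0 <= u <= 1 ->
  lyap (slide y i u) = lyap y - coord i y * u.
Proof.
move=> u01; rewrite /lyap; under eq_bigr do rewrite coord_slide// !mulrDr.
rewrite !big_split/= !(sum_pick (fun j => (m - j)%:R)) ltn_ord -addrA; congr (_ + _).
have mi : (m - i)%:R = (m - i.+1)%:R + 1 :> R.
  by rewrite natr1 subnSK.
case: ifPn => [im|]; first by rewrite mi; ring.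
rewrite -leqNgt => mi1; rewrite mi (eqP mi1 : (m - i.+1)%N = 0%N); ring.
Qed.

Lemma lyap_push (y : T) z : (0 < m)%N ->
  lyap (push y z) = lyap y + m%:R * Num.max 0 z.
Proof.
move=> m0; rewrite /lyap; under eq_bigr do rewrite coord_push mulrDr.
by rewrite big_split/= (sum_pick (fun j => (m - j)%:R)) m0 subn0.
Qed.

Lemma total_rate_slide (y : T) (i : 'I_m) (u : R) : 0 <= u <= 1 ->
  total_rate (slide y i u) <= total_rate y.
Proof.
move=> u01; rewrite /total_rate lerD2l; under eq_bigr do rewrite coord_slide//.
rewrite !big_split/= !sum_pick1 ltn_ord -addrA gerDl.
have cu0 : 0 <= coord i y * u by case/andP: u01 => u0 _; rewrite mulr_ge0// coord_ge0.
by case: ifP => _; rewrite ?addNr// addr0 oppr_le0.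
Qed.

Lemma total_rate_push (y : T) z :
  total_rate (push y z) <= total_rate y + Num.max 0 z.
Proof.
rewrite /total_rate -addrA lerD2l; under eq_bigr do rewrite coord_push.
rewrite big_split/= lerD2l.
by rewrite sum_pick1; case: ifP => _; rewrite // le_max lexx.
Qed.

Local Open Scope ereal_scope.

Lemma integral_unif_affine (a c : R) :
  \int[@lebesgue_measure R]_(u in `[0%R, 1%R]) (a - c * u)%:E = (a - c / 2)%:E.
Proof.
rewrite (@continuous_FTC2 _ _ (fun u => a * u - c / 2 * u ^+ 2)%R _ _ ltr01).
- by rewrite -EFinB; congr EFin; ring.
- apply: continuous_subspaceT => u; apply: cvgB; first exact: cvg_cst.
  by apply: cvgM; [exact: cvg_cst|exact: cvg_id].
- have cF : continuous (fun u => a * u - c / 2 * u ^+ 2)%R.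
    move=> u; apply: cvgB; first by apply: cvgM; [exact: cvg_cst|exact: cvg_id].
    by apply: cvgM; [exact: cvg_cst|exact: exprn_continuous].
  split; first by move=> u _; exact: ex_derive.
  + exact: cvg_at_right_filter (cF _).
  + exact: cvg_at_left_filter (cF _).
- move=> u _; rewrite derive1E; apply: derive_val; apply: is_derive_eq.
  by rewrite /GRing.scale/=; field.
Qed.

Lemma integral_theta_max : \int[theta]_z (Num.max 0 z)%R%:E = 1.
Proof.
rewrite -theta_mean; apply: (eq_integral_full (D := [set z : R | 0 < z]%R)) => //.
  by rewrite -set_itvoy; exact: measurable_itv.
by move=> z /= z0; rewrite max_r// ltW.
Qed.

Lemma jint_lyap y : (0 < m)%N ->
  jint K (EFin \o lyap) y =
  (total_rate y * lyap y + m%:R - sqsum y / 2)%:E.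
Proof.
move=> m0; have mV : mpos (EFin \o lyap).
  by apply: mpos_EFin; [exact: lyap_mfun|exact: lyap_ge0].
rewrite jint_gap//; have [mV_ V0] := mV.
have -> : \int[theta]_z (EFin \o lyap) (push y z) = (lyap y + m%:R)%:E.
  under eq_integral do rewrite /= lyap_push// EFinD EFinM.
  rewrite ge0_integralD//; last 3 first.
  - by move=> z _; rewrite lee_fin lyap_ge0.
  - by move=> z _; rewrite -EFinM lee_fin mulr_ge0// le_max lexx.
  - by apply: emeasurable_funM => //; apply/measurable_EFinP/measurable_maxr.
  rewrite integral_cst// ge0_integralZl//; last 2 first.
  - by apply/measurable_EFinP/measurable_maxr.
  - by move=> z _; rewrite lee_fin le_max lexx.
  rewrite integral_theta_max mule1 [X in _ * X + _](probability_setT theta).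
  by rewrite mule1 EFinD.
have E (i : 'I_m) : (coord i y)%:E * \int[unif]_u (EFin \o lyap) (slide y i u) =
    (coord i y * (lyap y) - coord i y ^+ 2 / 2)%:E.
  rewrite integral_unif//; last exact: measurableT_comp mV_ (slide_mfun1 y i).
  have -> : \int[@lebesgue_measure R]_(u in `[0%R, 1%R]) (EFin \o lyap) (slide y i u) =
      (lyap y - coord i y / 2)%:E.
    rewrite -integral_unif_affine; apply: eq_integral => u.
    by rewrite inE/= in_itv/= => u01; rewrite lyap_slide.
  by rewrite -EFinM; congr EFin; ring.
rewrite (eq_bigr _ (fun i _ => E i)) sumEFin -EFinD; congr EFin.
rewrite sumrB -!mulr_suml /total_rate /sqsum; ring.
Qed.

(** The difference of the two sides is the sum of the squares of [coord i y - c]. The value c = 1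
    bounds the jump rate by the drift; c equal to the mean of the coordinates gives
    Cauchy-Schwarz. *)
Lemma sqsum_ge (c : R) (y : T) :
  (2 * c * (\sum_(i < m) coord i y) - m%:R * c ^+ 2 <= sqsum y)%R.
Proof.
rewrite -subr_ge0 /sqsum.
have -> : (\sum_(i < m) coord i y ^+ 2 - (2 * c * \sum_(i < m) coord i y - m%:R * c ^+ 2) =
    \sum_(i < m) (coord i y - c) ^+ 2)%R.
  transitivity (\sum_(i < m) (coord i y ^+ 2 + - (2 * c * coord i y) + c ^+ 2))%R.
    rewrite !big_split/= sumrN -mulr_sumr sumr_const card_ord.
    by rewrite -[(c ^+ 2 *+ m)%R]mulr_natl; ring.
  by apply: eq_bigr => i _; ring.
by apply: sumr_ge0 => i _; exact: sqr_ge0.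
Qed.

Lemma lyap_le (y : T) : (lyap y <= m%:R * \sum_(i < m) coord i y)%R.
Proof.
rewrite mulr_sumr; apply: ler_sum => i _; apply: ler_wpM2r; first exact: coord_ge0.
by rewrite ler_nat leq_subr.
Qed.

Lemma lyap_sq (y : T) : (0 < m)%N -> (lyap y ^+ 2 <= m%:R ^+ 3 * sqsum y)%R.
Proof.
move=> m0; have m0' : (0 < m%:R :> R)%R by rewrite ltr0n.
set S := (\sum_(i < m) coord i y)%R.
have S0 : (0 <= S)%R by apply: sumr_ge0 => i _; exact: coord_ge0.
apply: (@le_trans _ _ ((m%:R * S) ^+ 2)%R).
  by rewrite !expr2; apply: ler_pM; [exact: lyap_ge0|exact: lyap_ge0|exact: lyap_le..].
have := sqsum_ge (S / m%:R) y; rewrite -/S => h.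
have -> : ((m%:R * S) ^+ 2 = m%:R ^+ 3 * (2 * (S / m%:R) * S - m%:R * (S / m%:R) ^+ 2))%R.
  by field; rewrite gt_eqF.
by apply: ler_wpM2l => //; rewrite exprn_ge0// ltW.
Qed.

Lemma gap_trans1 (t : R) y : (0 < m)%N -> (0 <= t)%R -> trans K t (fun=> 1) y = 1.
Proof.
(* With S the sum of the coordinates and q that of their squares, L V + rate = m - q / 2 + 1 + S,
   and S <= (q + m) / 2 by [sqsum_ge 1]; the result is at most 3 m / 2 + 1. *)
move=> m0 t0; apply: (nonexplosion (V := lyap) (C := (2 * m%:R + 1)%R)) => //.
- exact: lyap_mfun.
- exact: lyap_ge0.
move=> z; rewrite jint_lyap// -EFinD lee_fin.
rewrite -[jrate _ _]/(total_rate z).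
have := sqsum_ge 1 z; have : total_rate z = (1 + \sum_(i < m) coord i z)%R by [].
have : (0 <= m%:R :> R)%R by [].
set S := (\sum_(i < m) coord i z)%R; set q := sqsum z; set r := total_rate z.
by move=> m0' -> ; rewrite expr1n; nra.
Qed.

(** The right-hand side is the tangent at v to the concave function w -> w / (1 + a w). It replaces
    this function by an affine one, whose integral against the kernel follows from that of
    [lyap]. *)
Lemma come_down_step (a v w : R) : (0 <= a)%R -> (0 <= v)%R -> (0 <= w)%R ->
  (w / (1 + a * w) <= (a * v ^+ 2 + w) / (1 + a * v) ^+ 2)%R.
Proof.
move=> a0 v0 w0.
have h1 : (0 < 1 + a * w)%R by rewrite ltr_wpDr// mulr_ge0.
have h2 : (0 < (1 + a * v) ^+ 2)%R by rewrite exprn_gt0// ltr_wpDr// mulr_ge0.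
rewrite ler_pdivrMr// mulrAC ler_pdivlMr// -subr_ge0.
have -> : ((a * v ^+ 2 + w) * (1 + a * w) - w * (1 + a * v) ^+ 2 =
   a * (v - w) ^+ 2)%R by ring.
by rewrite mulr_ge0// sqr_ge0.
Qed.

(* v / (1 + c t v) solves v' = - c v^2, the rate at which the drift
   - |y|^2 / 2 of the Lyapunov function pulls it down from any starting value;
   it is bounded by 1 / (c t) uniformly in the starting point. *)
Lemma come_down (t : R) : (0 < m)%N -> (0 < t)%R ->
  exists2 M : R, (0 < M)%R & forall y,
  trans K t (EFin \o (\1_[set z | M < lyap z]%R : T -> R)) y <= (2^-1)%:E.
Proof.
move=> m0 t0; have m0' : (0 < m%:R :> R)%R by rewrite ltr0n.
(* By [lyap_sq], half the sum of squares is at least c V^2. *)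
pose c : R := ((2 * m%:R ^+ 3)^-1)%R.
have c0 : (0 < c)%R by rewrite invr_gt0 mulr_gt0// exprn_gt0.
(* M is twice the bound of the supersolution at time t. Division by M, as in Markov's inequality,
   makes the supersolution dominate the indicator at time 0 and be at most 1/2 at time t. *)
pose M : R := (2 * ((c * t)^-1 + m%:R * t))%R.
have M0 : (0 < M)%R.
  by rewrite mulr_gt0// addr_gt0 ?invr_gt0 ?mulr_gt0.
exists M => // y.
pose H (z : T) (s : R) : R := ((lyap z / (1 + c * s * lyap z) + m%:R * s) / M)%R.
pose H' (z : T) (s : R) : R := ((m%:R - c * lyap z ^+ 2 / (1 + c * s * lyap z) ^+ 2) / M)%R.
have den z s : (0 <= s)%R -> (0 < 1 + c * s * lyap z)%R.
  by move=> s0; rewrite ltr_wpDr// !mulr_ge0 ?lyap_ge0// ltW.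
have H0 z s : (0 <= s)%R -> (0 <= H z s)%R.
  move=> s0; apply: divr_ge0; last exact: ltW.
  apply: addr_ge0; last by rewrite mulr_ge0.
  by apply: divr_ge0; [exact: lyap_ge0|rewrite ltW// den].
have mA : measurable [set z | M < lyap z]%R.
  rewrite (_ : [set z | _] = [set: T] `&` lyap @^-1` `]M, +oo[%classic).
    by apply: lyap_mfun => //; exact: measurable_itv.
  by rewrite setTI; apply/seteqP; split => z /=; rewrite in_itv/= andbT.
pose u (s : R) (z : T) := (H z `|s|%R)%:E.
have mu2 : mpos2 u.
  split; last by move=> s z; rewrite lee_fin H0.
  apply/measurable_EFinP; apply: measurable_funM => //.
  have mV : measurable_fun setT (fun p : R * T => lyap p.2).
    exact: measurableT_comp lyap_mfun _.
  have ms : measurable_fun setT (fun p : R * T => `|p.1|%R) by exact: measurableT_comp.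
  apply: measurable_funD; last exact: measurable_funM.
  apply: measurable_funM => //; apply: measurable_inv_pos; last by move=> p; exact: den.
  by apply: measurable_funD => //; apply: measurable_funM => //; exact: measurable_funM.
apply: (@le_trans _ _ (u t y)).
  apply: (trans_le_FTC (H := H) (H' := H')) => //; last exact: ltW.
  - by apply: mpos_EFin.
  - by move=> z s s0; rewrite /u ger0_norm.
  - move=> z s s0; have d0 := den z s s0.
    have dn : is_derive s (1:R)%R (fun s => 1 + c * s * lyap z)%R (c * lyap z)%R.
      by apply: is_derive_eq; rewrite /GRing.scale/=; ring.
    have dV := is_deriveV (f := fun s => (1 + c * s * lyap z)%R) (lt0r_neq0 d0) dn.
    apply: is_derive_eq; rewrite /GRing.scale/= /H' ; field.
    by rewrite !gt_eqF.
  - move=> z s s0; have d0 := den z s s0.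
    have cl : {for s, continuous (fun s => 1 + c * s * lyap z)%R}.
      apply: cvgD; first exact: cvg_cst.
      by apply: cvgM; [apply: cvgM; [exact: cvg_cst|exact: cvg_id]|exact: cvg_cst].
    apply: cvgM; last exact: cvg_cst.
    apply: cvgB; first exact: cvg_cst.
    apply: cvgM; first exact: cvg_cst.
    apply: cvgV; first by rewrite expf_neq0// gt_eqF.
    exact: (cvgM cl cl).
  - move=> z; rewrite /u normr0 /H !(mulr0, mul0r, addr0) divr1 /= lee_fin indicE.
    have [|] := boolP (z \in _) => [/set_mem /= /ltW zM|_].
      by rewrite ler_pdivlMr// mul1r.
    by rewrite divr_ge0 ?lyap_ge0// ltW.
  - move=> z s s0; rewrite -[jrate _ _]/(total_rate z).
    set v := lyap z; have v0 : (0 <= v)%R by exact: lyap_ge0.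
    (* k and b are the slope and the intercept of the tangent at v to the supersolution at time s,
       as a function of V. *)
    pose k := ((1 + c * s * v) ^- 2 / M)%R.
    have k0 : (0 <= k)%R.
      by rewrite divr_ge0 ?(ltW M0)// invr_ge0 exprn_ge0// ltW// den.
    pose b := (k * (c * s * v ^+ 2) + m%:R * s / M)%R.
    have cs0 : (0 <= c * s)%R by rewrite mulr_ge0// ltW.
    have b0 : (0 <= b)%R.
      apply: addr_ge0.
        by apply: mulr_ge0 => //; apply: mulr_ge0 => //; exact: sqr_ge0.
      by apply: divr_ge0; [rewrite mulr_ge0|exact: ltW].
    have mV : mpos (EFin \o lyap : T -> \bar R).
      by apply: mpos_EFin; [exact: lyap_mfun|exact: lyap_ge0].
    apply: (@le_trans _ _ (jint K (fun w => b%:E + k%:E * (EFin \o lyap) w) z)).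
      apply: le_jint.
      - exact: mpos2_mpos.
      - by apply: mposD; [exact: mpos_cst|exact: mposZ].
      - move=> w; rewrite /u ger0_norm// /H /= -EFinM -EFinD lee_fin /b /k.
        rewrite mulrDl [leRHS](_ : _ = (c * s * v ^+ 2 + lyap w) /
          (1 + c * s * v) ^+ 2 / M + m%:R * s / M)%R.
          by rewrite lerD2r ler_pM2r ?invr_gt0//; exact: come_down_step (lyap_ge0 w).
        by rewrite -/v; ring.
    rewrite jintD; [|exact: mpos_cst|exact: mposZ].
    rewrite jint_cst// jintZ// jint_lyap// -EFinM -EFinD lee_fin.
    rewrite -[jrate _ _]/(total_rate z) -/v.
    have hv := lyap_sq z m0; rewrite -/v in hv.
    set q := sqsum z in hv *; set r := total_rate z.
    have d0 : (0 < 1 + c * s * v)%R by exact: den.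
    have e1 : (r * H z s = b * r + k * (r * v))%R.
      by rewrite /H /b /k -/v; field; rewrite !gt_eqF.
    have e2 : (H' z s = m%:R / M - k * (c * v ^+ 2))%R.
      by rewrite /H' /k -/v; field; rewrite !gt_eqF.
    rewrite e1 e2 -subr_ge0.
    have km : (k * m%:R <= m%:R / M)%R.
      rewrite /k mulrAC ler_pM2r ?invr_gt0// mulrC ler_piMr// invf_le1 ?exprn_gt0//.
      by rewrite exprn_ege1// lerDl mulr_ge0.
    have kc : (k * (c * v ^+ 2) <= k * (q / 2))%R.
      apply: ler_wpM2l => //; rewrite /c mulrC ler_pdivrMr ?mulr_gt0 ?exprn_gt0//.
      by rewrite [leRHS](_ : _ = m%:R ^+ 3 * q)%R//; field.
    by move: km kc; set k1 := (k * (c * v ^+ 2))%R; lra.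
rewrite /u gtr0_norm// lee_fin /H ler_pdivrMr// /M mulKf// lerD2r.
set v := lyap y; have v0 : (0 <= v)%R by exact: lyap_ge0.
have d0 := den y t (ltW t0).
rewrite ler_pdivrMr//= -/v.
have ct : (0 < c * t)%R by rewrite mulr_gt0.
by rewrite mulrDr mulr1 mulKf ?gt_eqF// lerDr invr_ge0 ltW.
Qed.

End lyapunov.

(** * Minorization *)

Local Opaque step jint dec trans.

Section minorization.
Context {R : realType} (theta : probability R R) (m : nat).
Notation T := (state R m).
Notation unif := (uniform_prob (@ltr01 R)).
Notation mu := (@lebesgue_measure R).
Notation K := (gap_kernel theta m).
Hypothesis m_gt0 : (0 < m)%N.
Hypothesis theta_gt0 : theta [set z : R | 0 < z] = 1%E.
Hypothesis theta_mean : (\int[theta]_z z%:E = 1)%E.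
Local Open Scope ereal_scope.

Definition setc (y : T) (i : nat) (v : R) : T :=
  [tuple if j == i :> nat then v else tnth y j | j < m].

(* Integrates f over [0, a] in each of the last k coordinates; in particular
   fill a f m does not depend on y. *)
Fixpoint fill (a : R) (f : T -> \bar R) (k : nat) (y : T) : \bar R :=
  if k is k'.+1 then
    \int[mu]_(v in `[0%R, a]) fill a f k' (setc y (m - k) v)
  else f y.

Lemma setc_mfun i : measurable_fun setT (fun p : T * R => setc p.1 i p.2).
Proof.
apply/measurable_fun_tnthP => j.
rewrite (_ : _ \o _ = fun p : T * R =>
    if nat_of_ord j == i then p.2 else tnth p.1 j); last first.
  by apply/funext => p /=; rewrite tnth_mktuple.
case: (nat_of_ord j == i); first exact: measurable_snd.
have mt : measurable_fun setT (fun y : T => tnth y j) := measurable_tnth j.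
exact: (measurableT_comp mt measurable_fst).
Qed.

Lemma fill_mpos a f k : mpos f -> mpos (fill a f k).
Proof.
move=> mf; elim: k => [//|k [mk k0]]; split; last first.
  by move=> y; apply: integral_ge0.
apply: (@measurable_fun_integral_segment R _ _ (fun=> a)
  (fun y v => fill a f k (setc y (m - k.+1) v))) => //.
exact: measurableT_comp mk (setc_mfun _).
Qed.

Lemma fill_mfun_setc a f k y i : mpos f ->
  measurable_fun setT (fun v : R => fill a f k (setc y i v)).
Proof.
move=> mf; have [mk _] := fill_mpos a k mf; apply: measurableT_comp mk _.
apply: (measurableT_comp (setc_mfun i) (g := fun v : R => (y, v))).
exact: measurable_fun_pair.
Qed.

Lemma fillD a f g k y : mpos f -> mpos g ->
  fill a (fun z => f z + g z) k y = fill a f k y + fill a g k y.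
Proof.
move=> mf mg; elim: k y => [//|k IH] y /=.
rewrite -ge0_integralD//.
- by apply: eq_integral => v _; rewrite IH.
- by move=> v _; case: (fill_mpos a k mf).
- by apply: measurable_funTS; exact: fill_mfun_setc.
- by move=> v _; case: (fill_mpos a k mg).
- by apply: measurable_funTS; exact: fill_mfun_setc.
Qed.

Lemma fill1 a k y : (0 < a)%R -> fill a (fun=> 1) k y = (a ^+ k)%:E.
Proof.
move=> a0; elim: k y => [//|k IH] y /=.
under eq_integral do rewrite IH.
rewrite (integral_cst mu) //= lebesgue_measure_itv /= lte_fin a0 oppr0 adde0.
by rewrite -EFinM exprSr.
Qed.

Lemma eq_fill a f k (y y' : T) :
  (forall j : 'I_m, (j < m - k)%N -> tnth y j = tnth y' j) ->
  fill a f k y = fill a f k y'.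
Proof.
elim: k y y' => [|k IH] y y' yy' /=.
  by congr f; apply: eq_from_tnth => j; rewrite yy'// subn0.
apply: eq_integral => v _; apply: IH => j jk; rewrite !tnth_mktuple.
case: ifPn => // ji; apply: yy'; move: ji jk; rewrite subnS.
by case: (m - k)%N => // n; rewrite ltnS leq_eqVlt => /negbTE -> /=.
Qed.

Lemma jint_ge_slide g y (i : 'I_m) : mpos g ->
  (coord i y)%:E * \int[unif]_u g (slide y i u) <= jint K g y.
Proof.
move=> mg; have [_ g0] := mg.
have t0 (j : 'I_m) : 0 <= (coord j y)%:E * \int[unif]_u g (slide y j u).
  by rewrite mule_ge0 ?lee_fin ?coord_ge0// integral_ge0.
rewrite jint_gap// (bigD1 i)//= -addeA leeDl// adde_ge0//.
  by apply: sume_ge0 => j _.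
exact: integral_ge0.
Qed.

Lemma jint_ge_push g y : mpos g -> \int[theta]_z g (push y z) <= jint K g y.
Proof.
move=> mg; have [_ g0] := mg.
rewrite jint_gap// leeDr//; apply: sume_ge0 => j _.
by rewrite mule_ge0 ?lee_fin ?coord_ge0// integral_ge0.
Qed.

(** Under v = w - w u, the part of a gap w that remains after a uniform jump has density 1 / w on
    [0, w], and the jump rate w cancels it. The bound by Lebesgue measure on [0, a] is therefore the
    same for all w >= a. *)
Lemma integral_unif_ge (a w : R) (F G : R -> \bar R) : (0 < a)%R -> (a <= w)%R ->
  measurable_fun setT F -> (forall v, 0 <= F v) ->
  measurable_fun setT G -> (forall u, 0 <= G u) ->
  (forall u, (0 <= u <= 1)%R -> (0 <= w - w * u <= a)%R -> F (w - w * u)%R <= G u) ->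
  \int[mu]_(v in `[0%R, a]) F v <= w%:E * \int[unif]_u G u.
Proof.
move=> a0 aw mF F0 mG G0 FG; have w0 : (0 < w)%R by exact: lt_le_trans aw.
have mFa : measurable_fun setT (F \_ `[0%R, a]%classic).
  by apply/(measurable_restrictT _ _).1 => //; exact: measurable_funTS.
have Fa0 v : 0 <= (F \_ `[0%R, a]%classic) v by rewrite erestrict_ge0.
rewrite integral_mkcond (@ge0_integral_affine _ (- w)%R w)//; last first.
  by rewrite oppr_eq0 gt_eqF.
rewrite normrN gtr0_norm// integral_unif//; apply: lee_wpmul2l.
  by rewrite lee_fin ltW.
rewrite [leRHS]integral_mkcond; apply: ge0_le_integral => //.
- apply: measurableT_comp mFa _.
  by apply: measurable_funD => //; exact: measurable_funM.
- by apply/(measurable_restrictT _ _).1 => //; exact: measurable_funTS.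
- move=> u _; rewrite /patch !mem_setE !in_itv/=.
  have -> : (- w * u + w = w - w * u)%R by ring.
  case: ifPn => [wu|_]; last by case: ifP.
  have u01 : (0 <= u <= 1)%R.
    by case/andP: wu => wu0 wua; apply/andP; split; nra.
  by rewrite u01; exact: FG.
Qed.

(** * Spreading mass along the gaps *)

Section cube.
Variables (M a : R).
Hypothesis a_gt0 : (0 < a)%R.
(** The factor of [trans_ge_local] for one time unit, left in its form there. *)
Let c : R := (1 * expR (- (M * 1)) ^+ 2)%R.

Let c_ge0 : (0 <= c)%R.
Proof. by rewrite /c mul1r exprn_ge0// expR_ge0. Qed.

Lemma jint_slow_le f y (g := fun z => (\1_[set z | total_rate z <= M]%R z)%:E * f z) :
  mpos f -> (total_rate y <= M)%R ->
  mpos g /\ c%:E * jint K g y <= trans K 1 f y.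
Proof.
move=> mf yM; have [mf_ f0] := mf.
have mB : measurable [set z : T | total_rate z <= M]%R.
  rewrite (_ : [set z | _] = [set: T] `&` (@total_rate R m) @^-1` `]-oo, M]%classic).
    by apply: total_rate_mfun => //; exact: measurable_itv.
  by rewrite setTI; apply/seteqP; split => z /=; rewrite in_itv.
have mg : mpos g.
  split; last by move=> z; rewrite mule_ge0// lee_fin.
  by apply: emeasurable_funM => //; exact/measurable_EFinP.
split => //; apply: trans_ge_local => //.
- move=> z; rewrite /g indicE; case: (_ \in _); first by rewrite mul1e.
  by rewrite mul0e.
- move=> z; rewrite -[jrate _ _]/(total_rate z) => Mz.
  by rewrite /g indicE memNset ?mul0e//= => /(lt_le_trans Mz); rewrite ltxx.
Qed.

(** Each time unit is used for one jump. If gap m - k has size at least k a, the jumps that leave a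
    value v in [0, a] there pass at least (k - 1) a to the next gap, which is the hypothesis for k -
    1. Slides never increase the total rate, so M serves throughout. *)
Lemma fill_le_trans k f y : (k <= m)%N -> orthant y -> (total_rate y <= M)%R ->
  ((0 < k)%N -> (k%:R * a <= coord (m - k) y)%R) -> mpos f -> (forall z, f z <= 1) ->
  (c ^+ k)%:E * fill a f k y <= trans K k%:R f y.
Proof.
move=> + + + + mf f1; elim: k y => [|k IH] y km Oy yM ya.
  by rewrite expr0 mul1e /=; exact: trans0.
have t1 := gap_trans1 theta_gt0 theta_mean _ m_gt0.
have -> : k.+1%:R = (1 + k%:R)%R :> R by rewrite -natr1 addrC.
rewrite trans_add//.
have mk := trans_mpos K k%:R mf.
pose g z := (\1_[set z : T | total_rate z <= M]%R z)%:E * trans K k%:R f z.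
have [mg hg] : mpos g /\ c%:E * jint K g y <= trans K 1 (trans K k%:R f) y.
  exact: jint_slow_le.
apply: le_trans hg.
rewrite exprS EFinM -muleA; apply: lee_wpmul2l; first by rewrite lee_fin c_ge0.
have im : (m - k.+1 < m)%N by rewrite -subSn// subSS leq_subr.
apply: le_trans (jint_ge_slide y (Ordinal im) mg).
rewrite -[nat_of_ord _]/(m - k.+1)%N; set i := (m - k.+1)%N.
have ci : (a <= coord i y)%R.
  by apply: le_trans (ya isT); rewrite ler_peMl ?ler1n// ltW.
have [mfk fk0] := fill_mpos a k mf; have [mg_ g0] := mg.
rewrite [fill _ _ _ _]/= -/i -ge0_integralZl; last 4 first.
- exact: measurable_itv.
- by apply: measurable_funTS; exact: fill_mfun_setc.
- by move=> v _; exact: fk0.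
- by rewrite lee_fin exprn_ge0 ?c_ge0.
apply: integral_unif_ge => //.
- by apply: emeasurable_funM => //; exact: fill_mfun_setc.
- by move=> v; rewrite mule_ge0// lee_fin exprn_ge0 ?c_ge0.
- exact: measurableT_comp mg_ (slide_mfun1 y i).
move=> u u01 wua; have /andP[wu0 wu] := wua.
have rs : (total_rate (slide y i u) <= M)%R.
  by apply: le_trans yM; exact: (total_rate_slide y (Ordinal im)).
rewrite /g indicE mem_set//= mul1e.
(* The two states differ at most in coordinate i + 1, which [fill a f k] integrates out. *)
have <- : fill a f k (slide y i u) = fill a f k (setc y i (coord i y - coord i y * u)).
  apply: eq_fill => j jk; rewrite tnth_slide tnth_mktuple.
  have ji : (nat_of_ord j == i.+1) = false.
    by apply: ltn_eqF; rewrite /i -subSn// subSS.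
  rewrite ji addr0; case: ifPn => [/eqP ->//|_].
  by rewrite addr0 coord_orthant.
apply: IH => //; [exact: ltnW|exact: orthant_slide|move=> k0].
have iS : (i.+1 = m - k)%N by rewrite /i -subSn// subSS.
have im1 : (m - k < m)%N by rewrite ltn_subrL k0.
have := coord_slide y i (Ordinal im1) u01.
rewrite -[nat_of_ord _]/(m - k)%N -iS eqxx gtn_eqF// => ->.
have := ya isT; rewrite -natr1 mulrDl mul1r -/i.
have := coord_ge0 i.+1 y; lra.
Qed.

End cube.

(** The positive reals are covered by countably many intervals [1/(n+1), n+1], so one has positive
    mass. The lower end supplies mass to spread; the upper end keeps the rate bounded after the
    push. *)
Lemma theta_window : exists z0 z1 : R,
  (0 < z0)%R /\ 0 < theta `[z0, z1]%classic.
Proof.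
apply: contrapT => h.
have th0 n : theta `[n.+1%:R^-1%R, n.+1%:R : R]%classic = 0.
  apply/eqP; rewrite eq_le measure_ge0 andbT leNgt; apply/negP => tn.
  by apply: h; exists (n.+1%:R^-1)%R, n.+1%:R; rewrite invr_gt0.
have : theta [set z : R | 0 < z]%R <= \sum_(0 <= n <oo)
    theta `[n.+1%:R^-1%R, n.+1%:R : R]%classic.
  apply: measure_sigma_subadditive => //.
    by rewrite -set_itvoy; exact: measurable_itv.
  move=> z /= z0; pose n := maxn (Num.bound z) (Num.bound z^-1%R).
  have zi0 : (0 <= z^-1)%R by rewrite invr_ge0 ltW.
  exists n => //=; rewrite in_itv/=; apply/andP; split.
    rewrite invf_ple ?posrE//; apply: ltW; apply: lt_le_trans (archi_boundP zi0) _.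
    by rewrite ler_nat (leq_trans (leq_maxr _ _) (leqnSn n)).
  apply: ltW; apply: lt_le_trans (archi_boundP (ltW z0)) _.
  by rewrite ler_nat (leq_trans (leq_maxl _ _) (leqnSn n)).
rewrite theta_gt0 eseries0 ?leNgt ?lte_fin ?ltr01// => n _ _; exact: th0.
Qed.

Lemma total_rate_le_lyap (y : T) : (total_rate y <= 1 + lyap y)%R.
Proof.
rewrite /total_rate lerD2l; apply: ler_sum => i _.
by rewrite ler_peMl ?coord_ge0// ler1n subn_gt0.
Qed.

Lemma gap_doeblin : exists T0 eps : R, [/\ (0 <= T0)%R, (0 < eps)%R &
  forall f : T -> R, measurable_fun setT f -> (forall z, 0 <= f z <= 1)%R ->
    (forall y, eps%:E <= trans K T0 (EFin \o f) y) \/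
    (forall y, eps%:E <= trans K T0 (fun z => (1 - f z)%:E) y)].
Proof.
have t1 := gap_trans1 theta_gt0 theta_mean _ m_gt0.
have [z0 [z1 [z00 wp]]] := theta_window.
have [M1 M10 hM1] := come_down theta_gt0 theta_mean m_gt0 (@ltr01 R).
(* The total rate is at most 1 + M1 where [lyap <= M1], and a push from the window adds at most
   z1. *)
pose M := (1 + M1 + z1)%R.
(* A push of at least z0 = m a starts the chain of m slides. *)
pose a := (z0 / m%:R)%R.
have m0 : (0 < m%:R :> R)%R by rewrite ltr0n.
have a0 : (0 < a)%R by rewrite divr_gt0.
pose c : R := (1 * expR (- (M * 1)) ^+ 2)%R.
have c0 : (0 < c)%R by rewrite /c mul1r exprn_gt0// expR_gt0.
have mw : measurable `[z0, z1]%classic by exact: measurable_itv.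
have pfin : theta `[z0, z1]%classic \is a fin_num.
  by rewrite fin_num_measure.
pose p := fine (theta `[z0, z1]%classic).
have p0 : (0 < p)%R by rewrite fine_gt0// wp ltey_eq pfin.
have z10 : (0 <= z1)%R.
  rewrite leNgt; apply/negP => z1n; move: wp; rewrite set_itv_ge ?measure0 ?ltxx//.
  by rewrite bnd_simp -ltNge (lt_trans z1n).
pose y0 : T := [tuple 0%R | _ < m].
have one g : mpos g -> (forall z, g z <= 1) -> forall y, (lyap y <= M1)%R ->
    (c * p * c ^+ m)%:E * fill a g m y0 <= trans K (1 + m%:R) g y.
  move=> mg g1 y yM1; rewrite trans_add//.
  have ry : (total_rate y <= 1 + M1)%R.
    by apply: le_trans (total_rate_le_lyap y) _; rewrite lerD2l.
  have yM : (total_rate y <= M)%R by rewrite (le_trans ry)// /M lerDl.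
  have mk := trans_mpos K m%:R mg.
  pose h z := (\1_[set z : T | total_rate z <= M]%R z)%:E * trans K m%:R g z.
  have [mh hh] : mpos h /\ c%:E * jint K h y <= trans K 1 (trans K m%:R g) y.
    exact: jint_slow_le.
  apply: le_trans hh.
  have -> : (c * p * c ^+ m)%:E = c%:E * (p%:E * (c ^+ m)%:E).
    by rewrite -!EFinM mulrA.
  rewrite -!muleA; apply: lee_wpmul2l; first by rewrite lee_fin ltW.
  apply: le_trans (jint_ge_push y mh); have [mh_ h0] := mh.
  have [_ fl0] := fill_mpos a m mg.
  set C := (c ^+ m)%:E * fill a g m y0.
  have C0 : 0 <= C by rewrite mule_ge0// lee_fin exprn_ge0// ltW.
  have -> : p%:E * C = \int[theta]_(z in `[z0, z1]) C.
    by rewrite (integral_cst theta)// muleC /p fineK.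
  have mhp : measurable_fun setT (fun z => h (push y z)).
    exact: measurableT_comp mh_ (push_mfun1 y).
  apply: (@le_trans _ _ (\int[theta]_(z in `[z0, z1]) h (push y z))); last first.
    exact: ge0_subset_integral.
  apply: ge0_le_integral => //; first exact: measurable_funTS.
  move=> z /=; rewrite in_itv/= => /andP[zz0 zz1].
  have z_ge0 : (0 <= z)%R by rewrite (le_trans (ltW z00)).
  have rp : (total_rate (push y z) <= M)%R.
    apply: le_trans (total_rate_push y z) _.
    by rewrite max_r// /M lerD.
  rewrite /h indicE mem_set//= mul1e /C.
  rewrite (@eq_fill a g m y0 (push y z)); last by move=> j; rewrite subnn.
  apply: fill_le_trans => //; first exact: orthant_push.
  move=> _; rewrite subnn mulrC divfK ?gt_eqF//.
  have := coord_push y z (Ordinal m_gt0) => /= ->.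
  by rewrite max_r// (le_trans zz0)// lerDr coord_ge0.
(* One more time unit at the start brings [lyap] below M1 with probability at least 1/2, which
   removes the restriction on y. *)
have two g : mpos g -> (forall z, g z <= 1) -> forall y,
    (c * p * c ^+ m / 2)%:E * fill a g m y0 <= trans K (1 + (1 + m%:R)) g y.
  move=> mg g1 y; have m1 : (0 <= 1 + m%:R :> R)%R by rewrite addr_ge0.
  rewrite (trans_add t1 y m1 (@ler01 R) mg g1).
  have [_ fl0] := fill_mpos a m mg.
  have mA : measurable [set z : T | M1 < lyap z]%R.
    rewrite (_ : [set z | _] = [set: T] `&` (@lyap R m) @^-1` `]M1, +oo[%classic).
      by apply: lyap_mfun => //; exact: measurable_itv.
    by rewrite setTI; apply/seteqP; split => z /=; rewrite in_itv/= andbT.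
  pose I : T -> R := \1_[set z : T | M1 < lyap z]%R.
  have mI : measurable_fun setT I by exact: measurable_indic.
  have I01 z : (0 <= I z <= 1)%R.
    by rewrite /I indicE; case: (_ \in _); rewrite /= ?lexx ?ler01.
  have mJ : mpos (fun z => (1 - I z)%:E).
    apply: (mpos_EFin (f := fun z => 1 - I z)%R); first exact: measurable_funB.
    by move=> z; rewrite subr_ge0; case/andP: (I01 z).
  (* [transZ] needs a real constant; finiteness follows from g <= 1 and the finite volume of the
     cube. *)
  have fl_fin : fill a g m y0 \is a fin_num.
    rewrite ge0_fin_numE//; apply: (@le_lt_trans _ _ (fill a (fun=> 1) m y0)).
      pose g' z := 1 - g z.
      have gfin z : g z \is a fin_num.
        by rewrite ge0_fin_numE ?(le_lt_trans (g1 z)) ?ltry//; case: mg.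
      have mg' : mpos g'.
        split; first by apply: emeasurable_funB => //; case: mg.
        by move=> z; rewrite /g' sube_ge0 ?gfin ?orbT.
      have -> : (fun _ : T => 1) = (fun z => g z + g' z).
        by apply/funext => z; rewrite /g' addeC subeK.
      by rewrite fillD// leeDl//; case: (fill_mpos a m mg').
    by rewrite fill1// ltry.
  pose q := (c * p * c ^+ m * fine (fill a g m y0))%R.
  have q0 : (0 <= q)%R.
    apply: mulr_ge0; last exact: fine_ge0.
    by apply: mulr_ge0; [exact/ltW/mulr_gt0|exact/ltW/exprn_gt0].
  have le : trans K 1 (fun z => q%:E * (1 - I z)%:E) y <=
      trans K 1 (trans K (1 + m%:R) g) y.
    apply: le_transP; [exact: mposZ|exact: trans_mpos|move=> z].
    have [zM|zM] := leP (lyap z) M1.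
      rewrite /I indicE memNset/= ?subr0 ?mule1; last by rewrite ltNge zM.
      by rewrite /q (EFinM (c * p * c ^+ m)%R) fineK//; exact: one.
    rewrite /I indicE mem_set//= subrr mule0.
    by case: (trans_mpos K (1 + m%:R) mg).
  apply: le_trans le; rewrite transZ//.
  have h2 : (2^-1)%:E <= trans K 1 (fun z => (1 - I z)%:E) y.
    have := trans_compl t1 y (@ler01 R) mI I01; have := hM1 y.
    have := trans_fin_num t1 y (@ler01 R) mJ.
    have -> : EFin \o (\1_[set z | M1 < lyap z]%R : T -> R) = EFin \o I by [].
    case: (trans K 1 (EFin \o I) y) => // b.
    case: (trans K 1 _ y) => // b' _.
    by rewrite -EFinD !lee_fin => hb [bb]; lra.
  apply: le_trans (_ : q%:E * (2^-1)%:E <= _).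
    rewrite -[X in _ * X <= _](fineK fl_fin) -!EFinM lee_fin /q.
    by rewrite le_eqVlt; apply/predU1P; left; ring.
  by apply: lee_wpmul2l; rewrite ?lee_fin.
(* The last factor is half the volume of the cube, which the integral of f or of 1 - f attains. *)
pose eps := (c * p * c ^+ m / 2 * (a ^+ m / 2))%R.
have k0 : (0 < c * p * c ^+ m / 2)%R.
  by apply: divr_gt0 => //; apply: mulr_gt0; [exact: mulr_gt0|exact: exprn_gt0].
exists (1 + (1 + m%:R))%R, eps; split.
- by rewrite !addr_ge0.
- by rewrite mulr_gt0// divr_gt0// exprn_gt0.
move=> f mf f01.
have mpf : mpos (EFin \o f) by apply: mpos_EFin => // z; case/andP: (f01 z).
have mpf' : mpos (fun z => (1 - f z)%:E).
  apply: (mpos_EFin (f := fun z => 1 - f z)%R); first exact: measurable_funB.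
  by move=> z; rewrite subr_ge0; case/andP: (f01 z).
have sum : fill a (EFin \o f) m y0 + fill a (fun z => (1 - f z)%:E) m y0 = (a ^+ m)%:E.
  rewrite -fillD// -(fill1 m y0 a0); congr (fill a _ m y0).
  by apply/funext => z; rewrite /= -EFinD addrC subrK.
have [h|h] := leP (a ^+ m / 2)%:E (fill a (EFin \o f) m y0).
  left => y; apply: le_trans (two _ mpf _ y); last first.
    by move=> z; rewrite lee_fin; case/andP: (f01 z).
  by rewrite /eps EFinM; apply: lee_wpmul2l => //; rewrite lee_fin ltW.
right => y; apply: le_trans (two _ mpf' _ y); last first.
  by move=> z; rewrite lee_fin gerBl; case/andP: (f01 z).
rewrite /eps EFinM; apply: lee_wpmul2l; first by rewrite lee_fin ltW.
have [_ /(_ y0)] := fill_mpos a m mpf; move: h sum.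
case: (fill a (EFin \o f) m y0) => // b; case: (fill a _ m y0) => // b'.
by rewrite -EFinD lte_fin !lee_fin => hb [bb] _; lra.
Qed.

End minorization.

(** * Stationary law of the gap process *)

Local Opaque step jint dec trans.

Section stationary_law.
Context {R : realType} (theta : probability R R) (m : nat).
Notation T := (state R m).
Notation K := (gap_kernel theta m).
Hypothesis m_gt0 : (0 < m)%N.
Hypothesis theta_gt0 : theta [set z : R | 0 < z] = 1%E.
Hypothesis theta_mean : (\int[theta]_z z%:E = 1)%E.
Local Open Scope ereal_scope.

Lemma measurable_orthant : measurable (@orthant R m).
Proof.
rewrite (_ : @orthant R m = \bigcap_(j in [set: 'I_m])
    ([set: T] `&` (fun y => tnth y j) @^-1` `[0%R, +oo[%classic)).
  apply: fin_bigcap_measurable => // j _.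
  by apply: measurable_tnth => //; exact: measurable_itv.
apply/seteqP; split => y /= Oy j; last by have := Oy j Logic.I; rewrite /= in_itv/= andbT => -[].
by move=> _; split => //; rewrite /= in_itv/= andbT; exact: Oy.
Qed.

Local Transparent step dec.

(** Jumps from any state land in the orthant, so the kernel integrates the indicator of the
    complement to 0, and this indicator, constant in time, is a supersolution. *)
Lemma trans_orthant (t : R) y : (0 <= t)%R -> orthant y ->
  trans K t (EFin \o (\1_(~` @orthant R m) : T -> R)) y = 0.
Proof.
move=> t0 Oy; have mOC : measurable (~` @orthant R m).
  by apply: measurableC; exact: measurable_orthant.
set g := EFin \o _; have mg : mpos g by apply: mpos_EFin.
have gO z : orthant z -> g z = 0.
  by move=> Oz; rewrite /g /= indicE memNset//=; apply.
have jg z : jint K g z = 0.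
  have [mg_ g0] := mg; rewrite jint_gap// [X in _ + X](_ : _ = 0).
    rewrite adde0 big1// => i _; rewrite integral_unif//.
      rewrite integral0_eq ?mule0// => u; rewrite /= in_itv/= => u01.
      by apply: gO; exact: orthant_slide.
    exact: measurableT_comp mg_ (slide_mfun1 z i).
  by apply: integral0_eq => w _; apply: gO; exact: orthant_push.
apply/eqP; rewrite eq_le; apply/andP; split; last by case: (trans_mpos K t mg).
rewrite -[leRHS](gO y Oy); apply: (trans_le_super (u := fun=> g)) => //.
  exact: mpos2_cst.
move=> {t0}t {Oy}y t0.
rewrite /step; under eq_integral do rewrite jg mule0.
rewrite integral0 adde0 -[leRHS]mul1e; apply: lee_wpmul2r; first by case: mg.
rewrite lee_fin -expR0 ler_expR oppr_le0 mulr_ge0//.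
exact: total_rate_ge0.
Qed.

Lemma stationary_bounds (pi : probability T R) (t a b : R) (A : set T) :
  stationary theta pi -> (0 <= t)%R -> measurable A ->
  (forall y, a%:E <= trans K t (EFin \o (\1_A : T -> R)) y <= b%:E) ->
  a%:E <= pi A <= b%:E.
Proof.
move=> [piO st] t0 mA ab; rewrite -(st t t0 A mA).
have mO := measurable_orthant.
have mp : mpos (EFin \o (\1_A : T -> R)) by apply: mpos_EFin.
have [mt tr0] := trans_mpos K t mp.
have -> : \int[pi]_(y in @orthant R m) Ptrans theta t y A =
    \int[pi]_(y in @orthant R m) trans K t (EFin \o (\1_A : T -> R)) y.
  by apply: eq_integral => y /set_mem Oy; rewrite Ptrans_trans.
have cstE (c : R) : \int[pi]_(y in @orthant R m) (cst c%:E y) = c%:E.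
  by rewrite integral_cst// -[RHS]mule1; congr (_ * _).
apply/andP; split.
  (* The lower bound comes without a sign; a negative one is trivial. *)
  have [a0|a0] := leP 0%R a.
    rewrite -[leLHS]cstE; apply: ge0_le_integral => //; first exact: measurable_funTS.
    by move=> y _; case/andP: (ab y).
  apply: (@le_trans _ _ 0); first by rewrite lee_fin ltW.
  exact: integral_ge0.
rewrite -[leRHS]cstE; apply: ge0_le_integral => //; first exact: measurable_funTS.
by move=> y _; case/andP: (ab y).
Qed.

Lemma exists_stationary_unique :
  (exists pi : probability T R, stationary theta pi) /\
  (forall pi1 pi2 : probability T R,
     stationary theta pi1 -> stationary theta pi2 ->
     forall A : set T, measurable A -> pi1 A = pi2 A).
Proof.
have t1 := gap_trans1 theta_gt0 theta_mean _ m_gt0.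
have [T0 [eps [T00 eps0 db]]] := gap_doeblin m_gt0 theta_gt0 theta_mean.
pose y0 : T := [tuple 0%R | _ < m].
have Oy0 : orthant y0 by move=> j; rewrite tnth_mktuple.
(* The Doeblin alternative for f = 0 puts eps below a transition probability in either case. *)
have eps1 : (eps <= 1)%R.
  rewrite -lee_fin.
  have [|z|h|h] := db (fun=> 0%R); first exact: measurable_cst.
  - by rewrite lexx ler01.
  - apply: le_trans (h y0) _; apply: trans_le1 => //.
    exact: (mpos_cst (lexx 0%R)).
  - apply: le_trans (h y0) _; apply: trans_le1 => //.
    by move=> z; rewrite subr0.
have mO := measurable_orthant.
split.
  have [pi [st zero]] := ergodic y0 T00 eps0 eps1 t1 db.
  have piOC : pi (~` @orthant R m) = 0.
    apply: zero; first exact: measurableC.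
    by move=> t t0; exact: trans_orthant.
  have piO : pi (@orthant R m) = 1.
    by have := probability_setC pi (measurableC mO); rewrite setCK piOC sube0.
  exists pi; split => // t t0 A mA.
  have mp : mpos (EFin \o (\1_A : T -> R)) by apply: mpos_EFin.
  have [mt tr0] := trans_mpos K t mp.
  rewrite -(st t A t0 mA).
  rewrite [RHS](ge0_negligible_integral (N := ~` @orthant R m))//; last first.
    exact: measurableC.
  rewrite setTD setCK; apply: eq_integral => y /set_mem Oy.
  by rewrite Ptrans_trans.
move=> pi1 pi2 st1 st2 A mA.
have tk k : (0 <= k%:R * T0)%R by rewrite mulr_ge0.
have fin (p : probability T R) : p A = (fine (p A))%:E by rewrite fineK// fin_num_measure.
(* Both laws give A a mass in the same interval of length (1 - eps)^k. *)
have le (p q : probability T R) : stationary theta p -> stationary theta q ->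
    (fine (p A) <= fine (q A))%R.
  move=> sp sq; apply: (le_geometric_slack (c := 1%R) eps0 eps1) => // k.
  have [a ha] := confined T00 eps0 eps1 t1 db k mA.
  have bd y := ha _ y (lexx (k%:R * T0)%R).
  have /andP[_ pu] := stationary_bounds sp (tk k) mA bd.
  have /andP[ql _] := stationary_bounds sq (tk k) mA bd.
  move: pu ql; rewrite (fin p) (fin q) !lee_fin mul1r => pu ql.
  by apply: le_trans pu _; rewrite lerD2r.
rewrite (fin pi1) (fin pi2); congr EFin; apply/eqP.
by rewrite eq_le !le.
Qed.

End stationary_law.

Unset Implicit Arguments.

Theorem theorem3p1 (R : realType) (n : nat) (theta : probability R R) :
  (2 <= n)%N ->
  theta [set z : R | 0 < z] = 1%E ->
  (\int[theta]_z (z%:E) = 1)%E ->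
  (exists pi : probability (state R n.-1) R, stationary theta pi) /\
  (forall pi1 pi2 : probability (state R n.-1) R,
     stationary theta pi1 -> stationary theta pi2 ->
     forall A : set (state R n.-1), measurable A -> pi1 A = pi2 A).
Proof.
case: n => [|[|n]] // _ theta_gt0 theta_mean.
exact: exists_stationary_unique.
Qed.
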